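(* Let $(\Gamma,\mathfrak o,\mathfrak m,\mathfrak q)$ be a quantized Brauer graph and $A_\Gamma$ the associated Brauer graph algebra. Then $A_\Gamma$ is Koszul if and only if $A_\Gamma$ is quadratic and either $\Gamma=\mathbb A_2$ or $\Gamma$ has no truncated edges. For $d\ge3$, $A_\Gamma$ is $d$-Koszul if and only if $A_\Gamma$ is $d$-homogeneous.
   Context: Let $K$ be a field. A Brauer graph $(\Gamma,\mathfrak o,\mathfrak m)$ consists of a finite connected graph $\Gamma$ with at least one edge (loops and multiple edges allowed), a multiplicity function $\mathfrak m:\Gamma_0\to\mathbb Z_{>0}$ on the vertex set $\Gamma_0$, and, for each vertex $\alpha$, a cyclic ordering $\mathfrak o$ of the edges incident with $\alpha$ (a loop at $\alpha$ occurs twice in this cyclic ordering, the two occurrences being treated as distinct). The valency $\mathrm{val}(\alpha)$ is the number of edges incident with $\alpha$, loops counted twice. An edge $t$ is the successor of $s$ at $\alpha$ if $t$ directly follows $s$ in the cyclic ordering at $\alpha$ (if $\mathrm{val}(\alpha)=1$ the unique edge is its own successor). An edge $s$ is truncated at $\alpha$ if $\mathrm{val}(\alpha)=1$, $\mathfrak m(\alpha)=1$ and $s$ is the edge at $\alpha$; $s$ is a truncated edge if it is truncated at one of its endpoints. The successor sequence of $s$ at $\alpha$ is $s=s_0,s_1,\dots,s_{\mathrm{val}(\alpha)-1}$ with $s_{i+1}$ the successor of $s_i$ at $\alpha$. A quantizing function $\mathfrak q$ assigns $\mathfrak q_{s,\alpha}\in K\setminus\{0\}$ to each pair $(s,\alpha)$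 with $s$ incident with $\alpha$ and $s$ not truncated at either endpoint; $(\Gamma,\mathfrak o,\mathfrak m,\mathfrak q)$ is a quantized Brauer graph. The Brauer graph algebra $A_\Gamma=KQ_\Gamma/I_\Gamma$ (paths written left to right) is: if $\Gamma=\mathbb A_2$ with both multiplicities $1$, $A_\Gamma=K[x]/(x^2)$. Otherwise $Q_\Gamma$ has a vertex $v_s$ for each edge $s$, and for each vertex $\alpha$ and each occurrence of $t$ as the successor of $s$ at $\alpha$ with $s$ not truncated at $\alpha$, an arrow $v_s\to v_t$. For $s$ at $\alpha$ not truncated at $\alpha$, with successor sequence $s_0,\dots,s_{v-1}$, $v=\mathrm{val}(\alpha)$, $s_v=s_0$, let $C_{s,\alpha}=a_0a_1\cdots a_{v-1}$, where $a_r$ is the arrow for $s_{r+1}$ succeeding $s_r$ at $\alpha$. $I_\Gamma$ is generated by: type one: for each edge $s$ with endpoints $\alpha,\beta$ not truncated at either, $\mathfrak q_{s,\alpha}C_{s,\alpha}^{\mathfrak m(\alpha)}-\mathfrak q_{s,\beta}C_{s,\beta}^{\mathfrak m(\beta)}$; type two: for each edge $s$ truncated at $\alpha$ with other endpoint $\beta$, writing $C_{s,\beta}=b_0b_1\cdots b_{\mathrm{val}(\beta)-1}$, the path $C_{s,\beta}^{\mathfrak m(\beta)}b_0$; type three: each path $ab$ of length $2$ in $Q_\Gamma$ that is not a subpath of any $C_{t,\gamma}$. $\mathbb A_2$ is a single edge with two distinct endpoints. For $d\ge 2$, $\Lambda=KQ/I$ is $d$-homogeneous (quadratic if $d=2$)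 if $I$ has a minimal generating set of length-homogeneous elements of length exactly $d$. Such a $\Lambda$ is graded by path length, $\Lambda_0$ spanned by the vertices; $\Lambda$ is $d$-Koszul if the $n$-th projective in a minimal graded projective resolution of $\Lambda_0$ is generated in degree $\delta(n)$ for all $n$, where $\delta(n)=\frac n2 d$ for $n$ even and $\delta(n)=\frac{n-1}{2}d+1$ for $n$ odd; Koszul means $2$-Koszul.
   Formalization: In the type three relations, ''not a subpath of any C_{t,γ}'' is replaced by ''not a subpath of any C_{t,γ}^{m(γ)}''; this changes A_Γ only at vertices of valency 1 with multiplicity at least 2, where the literal relations would include a² and make the Koszul criterion false. *)

(* Defs.v *)
From HB Require Import structures.
From mathcomp Require Import all_boot all_order all_algebra all_fingroup.
Set Implicit Arguments. Unset Strict Implicit. Unset Printing Implicit Defensive.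
Import GRing.Theory.

Record quiver := Quiver {
  qV : finType; qA : finType; qs : qA -> qV; qt : qA -> qV }.

Definition qpath (Q : quiver) := (qV Q * seq (qA Q))%type.

Fixpoint vpath (Q : quiver) (v : qV Q) (s : seq (qA Q)) : bool :=
  match s with
  | [::] => true
  | a :: s' => (qs a == v) && vpath (qt a) s'
  end.

Definition pvalid (Q : quiver) (p : qpath Q) : bool := vpath p.1 p.2.
Definition psrc (Q : quiver) (p : qpath Q) : qV Q := p.1.
Definition ptgt (Q : quiver) (p : qpath Q) : qV Q := last p.1 [seq qt a | a <- p.2].

(* elements of KQ as formal finite linear combinations of paths *)
Definition kq (K : fieldType) (Q : quiver) := seq (K * qpath Q)%type.

Definition coef (K : fieldType) (Q : quiver) (x : kq K Q) (p : qpath Q) : K :=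
  (\sum_(t <- x | t.2 == p) t.1)%R.

Definition keq (K : fieldType) (Q : quiver) (x y : kq K Q) : Prop :=
  forall p, coef x p = coef y p.

Definition kmul (K : fieldType) (Q : quiver) (x y : kq K Q) : kq K Q :=
  flatten [seq [seq ((t.1 * u.1)%R, (t.2.1, t.2.2 ++ u.2.2)) | u <- y &
                 [&& pvalid t.2, pvalid u.2 & ptgt t.2 == psrc u.2]] | t <- x].

Definition kscale (K : fieldType) (Q : quiver) (c : K) (x : kq K Q) : kq K Q :=
  [seq ((c * t.1)%R, t.2) | t <- x].

Definition ksub (K : fieldType) (Q : quiver) (x y : kq K Q) : kq K Q :=
  x ++ kscale (-1)%R y.

Definition kpath (K : fieldType) (Q : quiver) (p : qpath Q) : kq K Q := [:: (1%R, p)].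

Definition in_ideal (K : fieldType) (Q : quiver) (R : seq (kq K Q)) (x : kq K Q) : Prop :=
  exists ts : seq (K * qpath Q * nat * qpath Q),
    keq x (flatten [seq kscale t.1.1.1
                      (kmul (kmul (kpath K t.1.1.2) (nth [::] R t.1.2)) (kpath K t.2))
                   | t <- ts]).

Definition homog (K : fieldType) (Q : quiver) (d : nat) (x : kq K Q) : Prop :=
  forall p, (coef x p != 0)%R -> pvalid p /\ size p.2 = d.

(* presented algebra KQ/I, I generated by prel *)
Record pres (K : fieldType) := Pres { pQ : quiver; prel : seq (kq K pQ) }.

Definition d_homogeneous (K : fieldType) (A : pres K) (d : nat) : Prop :=
  2 <= d /\
  exists G : seq (kq K (pQ A)),
    (forall x, in_ideal (prel A) x <-> in_ideal G x) /\
    (forall i, i < size G -> homog d (nth [::] G i)) /\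
    (forall i, i < size G -> ~ in_ideal (take i G ++ drop i.+1 G) (nth [::] G i)).

Definition quadratic (K : fieldType) (A : pres K) : Prop := d_homogeneous A 2.

(* Minimal graded projective resolutions of Lambda_0 (right modules)   *)
(* P_n = (+)_l e_{v_l} Lambda [-deg_l], with generators gen n = (v_l,deg_l);
   d_n : P_n -> P_{n-1} given by mat n k l in e_{v'_k} KQ e_{v_l},
   d_n(x)_k = sum_l mat n k l * x_l.                                    *)

Section Res.
Variables (K : fieldType) (A : pres K).
Local Notation Q := (pQ A).
Local Notation R := (prel A).

Definition pelt (gen : nat -> seq (qV Q * nat)) (n : nat) (x : seq (kq K Q)) : Prop :=
  size x = size (gen n) /\
  forall l xl vl dl p, onth x l = Some xl -> onth (gen n) l = Some (vl, dl) ->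
    (coef xl p != 0)%R -> pvalid p /\ psrc p = vl.

Definition dmap (gen : nat -> seq (qV Q * nat)) (mat : nat -> nat -> nat -> kq K Q)
    (n : nat) (x : seq (kq K Q)) : seq (kq K Q) :=
  mkseq (fun k => flatten (mkseq (fun l => kmul (mat n k l) (nth [::] x l))
                                 (size (gen n))))
        (size (gen n.-1)).

Definition min_graded_res (gen : nat -> seq (qV Q * nat))
    (mat : nat -> nat -> nat -> kq K Q) : Prop :=
  [/\ (* P_0 is the graded projective cover of Lambda_0 *)
      gen 0 = [seq (v, 0) | v <- enum (qV Q)],
      (* d_{n+1} is a graded map whose entries lie in the radical (minimality) *)
      (forall n k l vk dk vl dl p,
         onth (gen n) k = Some (vk, dk) -> onth (gen n.+1) l = Some (vl, dl) ->
         (coef (mat n.+1 k l) p != 0)%R ->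
         [/\ pvalid p, psrc p = vk, ptgt p = vl, 0 < size p.2 & dk + size p.2 = dl]),
      (* exactness at P_0: ker(P_0 -> Lambda_0) = im d_1 *)
      (forall x, pelt gen 0 x ->
         ((forall l xl v dv, onth x l = Some xl -> onth (gen 0) l = Some (v, dv) ->
              coef xl (v, [::]) = 0%R) <->
          exists y, pelt gen 1 y /\
            forall k, k < size (gen 0) ->
              in_ideal R (ksub (nth [::] (dmap gen mat 1 y) k) (nth [::] x k))))
    &
      (forall n x, pelt gen n.+1 x ->
         ((forall k, k < size (gen n) -> in_ideal R (nth [::] (dmap gen mat n.+1 x) k)) <->
          exists y, pelt gen n.+2 y /\
            forall k, k < size (gen n.+1) ->
              in_ideal R (ksub (nth [::] (dmap gen mat n.+2 y) k) (nth [::] x k))))].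

End Res.

Definition delta (d n : nat) : nat :=
  if odd n then (n./2 * d + 1)%N else (n./2 * d)%N.

Definition dKoszul (K : fieldType) (A : pres K) (d : nat) : Prop :=
  d_homogeneous A d /\
  exists gen mat, @min_graded_res K A gen mat /\
    forall n g, g \in gen n -> g.2 = delta d n.

Definition Koszul (K : fieldType) (A : pres K) : Prop := dKoszul A 2.

(* Brauer graphs, encoded by half-edges (edge occurrences at vertices) *)

Record bgraph := BGraph {
  bV : finType;
  bE : finType;
  bH : finType;              (* half-edges = occurrences of an edge at a vertex *)
  hv : bH -> bV;
  he : bH -> bE;
  bsucc : {perm bH};         (* successor in the cyclic ordering at the vertex *)
  bmult : bV -> nat }.

Definition is_bgraph (G : bgraph) : Prop :=
  0 < #|bE G| /\
  (forall s : bE G, #|[set h | he h == s]| = 2) /\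
  (forall h, hv (bsucc G h) = hv h) /\
  (forall h h', hv h = hv h' -> exists k, iter k (bsucc G) h = h') /\
  (forall v : bV G, exists h, hv h = v) /\
  (forall h h' : bH G, connect (fun x y => (he x == he y) || (hv x == hv y)) h h') /\
  (forall v : bV G, 0 < bmult v).

Section Brauer.
Variable G : bgraph.

Definition valency (v : bV G) : nat := #|[set h | hv h == v]|.

Definition truncv (v : bV G) : bool := (valency v == 1%N) && (bmult v == 1%N).
Definition ntrunc (h : bH G) : bool := ~~ truncv (hv h).

Definition halves (s : bE G) : seq (bH G) := [seq h <- enum (bH G) | he h == s].

Definition etrunc (s : bE G) : bool := has (fun h => truncv (hv h)) (halves s).

Definition isA2 : bool :=
  (#|bE G| == 1%N) &&
  [exists s, match halves s with [:: h1; h2] => hv h1 != hv h2 | _ => false end].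

Definition A2_11 : bool := isA2 && [forall v : bV G, bmult v == 1%N].

Definition quantizing (K : fieldType) (q : bE G -> bV G -> K) : Prop :=
  forall h, ~~ etrunc (he h) -> (q (he h) (hv h) != 0)%R.

Definition bA := {h : bH G | ntrunc h}.
HB.instance Definition _ := Finite.on bA.

Definition bquiver : quiver :=
  @Quiver (bE G) bA (fun a => he (val a)) (fun a => he (bsucc G (val a))).

Definition toA (h : bH G) : option bA := insub h.

Definition succseq (h : bH G) : seq (bH G) := traject (bsucc G) h (valency (hv h)).

Definition cycpow (h : bH G) (m : nat) : seq bA := pmap toA (flatten (nseq m (succseq h))).

Definition Cpow (h : bH G) : qpath bquiver := (he h, cycpow h (bmult (hv h))).

Section Rel.
Variables (K : fieldType) (q : bE G -> bV G -> K).

Definition type1 (s : bE G) : seq (kq K bquiver) :=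
  match halves s with
  | [:: h1; h2] =>
      if ntrunc h1 && ntrunc h2 then
        [:: [:: (q (he h1) (hv h1), Cpow h1); ((- q (he h2) (hv h2))%R, Cpow h2)]]
      else [::]
  | _ => [::]
  end.

Definition t2path (h : bH G) : qpath bquiver :=
  (he h, pmap toA (flatten (nseq (bmult (hv h)) (succseq h)) ++ [:: h])).

Definition type2 (s : bE G) : seq (kq K bquiver) :=
  match halves s with
  | [:: h1; h2] =>
      if ~~ ntrunc h1 && ntrunc h2 then [:: [:: (1%R, t2path h2)]]
      else if ntrunc h1 && ~~ ntrunc h2 then [:: [:: (1%R, t2path h1)]]
      else [::]
  | _ => [::]
  end.

Definition type3 : seq (kq K bquiver) :=
  flatten [seq [seq [:: (1%R, (he (val a), [:: a; b]) : qpath bquiver)]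
                 | b <- enum (bA : finType) &
                   (he (bsucc G (val a)) == he (val b)) &&
                   ~~ has (fun h => infix [:: a; b] (cycpow h (bmult (hv h))))
                          [seq h <- enum (bH G) | ntrunc h]]
          | a <- enum (bA : finType)].

Definition brels : seq (kq K bquiver) :=
  flatten [seq type1 s ++ type2 s | s <- enum (bE G)] ++ type3.

End Rel.
End Brauer.

Definition loopquiver : quiver := @Quiver unit unit (fun _ => tt) (fun _ => tt).
Definition xsq (K : fieldType) : pres K :=
  @Pres K loopquiver [:: [:: (1%R, (tt, [:: tt; tt]) : qpath loopquiver)]].

Definition bga (K : fieldType) (G : bgraph) (q : bE G -> bV G -> K) : pres K :=
  if A2_11 G then xsq K else @Pres K (bquiver G) (brels q).

(* Main.v *)
(* Write L for the length of the path C^m around a vertex. A d-homogeneous ideal detects L: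
   if it is quadratic then L = 2 everywhere, and if d >= 3 then there are no relations of
   type three, so every edge is truncated, the graph is a star, and A is the path algebra of
   an oriented cycle modulo all paths of length d = L + 1. The latter has a resolution by
   multiplication with paths of length 1 and d - 1 alternately (as has K[x]/(x^2)).

   If L = 2 and no edge is truncated, then the universal cover of the quiver is a doubled line
   a_i : i -> i + 1, b_i : i + 1 -> i with the relations aa = bb = 0 and ab ~ ba, and the simple
   module at 0 is resolved by projectives with one generator for each pair (i, j), i + j = n,
   at the vertex i - j.

   If L = 2 and some edge is truncated, let u_n(v) be the number of generators at v of the
   n-th term of a linear resolution. Exactness gives
   u_(n+2)(v) + u_n(v) = sum over the arrows b : w -> v of u_(n+1)(w). As every vertex has at
   most two outgoing arrows and a truncated one only one, sum_v u_n(v) is concave in n with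
   defect u_n at the truncated vertex. Being nonnegative it cannot decrease, so the defect
   is eventually zero; by connectedness all u_n vanish for large n, hence for all n, whereas
   u_0 = 1. *)

Require Import Defs.
From mathcomp Require Import all_boot all_order all_algebra all_fingroup.
From mathcomp Require Import zify ring.
From Stdlib Require Import Classical.
Set Implicit Arguments. Unset Strict Implicit. Unset Printing Implicit Defensive.
Import GRing.Theory.

(** * Path algebras and ideals *)

Section PathAlgebra.
Variables (K : fieldType) (Q : quiver).
Local Open Scope ring_scope.
Implicit Types (x y z r : kq K Q) (p a b : qpath Q) (v w : qV Q) (s : seq (qA Q)).

Lemma vpath_cat v s1 s2 :
  vpath v (s1 ++ s2) = vpath v s1 && vpath (ptgt (v, s1)) s2.
Proof.
elim: s1 v => [|a s1 IH] v //=; rewrite IH andbA /ptgt /=; congr (_ && vpath _ s2).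
Qed.

Lemma ptgt_cat v s1 s2 : ptgt (v, s1 ++ s2) = ptgt (ptgt (v, s1), s2).
Proof. by rewrite /ptgt /= map_cat last_cat. Qed.

Lemma coef_nil p : coef [::] p = 0 :> K.
Proof. by rewrite /coef big_nil. Qed.

Lemma coef_cons t x p : coef (t :: x) p = (if t.2 == p then t.1 else 0) + coef x p.
Proof. by rewrite /coef big_cons; case: ifP; rewrite ?add0r. Qed.

Lemma coef_cat x y p : coef (x ++ y) p = coef x p + coef y p.
Proof. by rewrite /coef big_cat. Qed.

Lemma coef_scale (c : K) x p : coef (kscale c x) p = c * coef x p.
Proof. by rewrite /coef /kscale big_map mulr_sumr. Qed.

Lemma coef_sub x y p : coef (ksub x y) p = coef x p - coef y p.
Proof. by rewrite /ksub coef_cat coef_scale mulN1r. Qed.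

Lemma coef_flatten (T : Type) (l : seq T) (F : T -> kq K Q) p :
  coef (flatten [seq F t | t <- l]) p = \sum_(t <- l) coef (F t) p.
Proof. by elim: l => [|t l IH]; rewrite ?big_nil ?coef_nil // big_cons /= coef_cat IH. Qed.

Lemma coef_path a p : coef (kpath K a) p = (a == p)%:R.
Proof. by rewrite /kpath coef_cons coef_nil addr0; case: eqP. Qed.

Lemma coef_neq0_mem x p : coef x p != 0 -> p \in [seq t.2 | t <- x].
Proof.
apply: contraR => pNx; rewrite /coef big_seq_cond big1 // => t /andP [tx /eqP tp].
by move/negP: pNx; case; rewrite -tp map_f.
Qed.

Definition ptake i p : qpath Q := (p.1, take i p.2).
Definition pdrop i p : qpath Q := (ptgt (ptake i p), drop i p.2).

(** A composable pair with concatenation [p] corresponds to exactly one cut position of [p], namely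
    the length of [t]. This turns the product of formal sums into a convolution over cut
    positions. *)
Lemma split_indicator (t u p : qpath Q) :
  ([&& pvalid t, pvalid u & ptgt t == psrc u] && ((t.1, t.2 ++ u.2) == p))%:R
  = (if pvalid p then
      \sum_(i < (size p.2).+1) (t == ptake i p)%:R * (u == pdrop i p)%:R else 0) :> K.
Proof.
case: t u p => [v1 s1] [v2 s2] [v s]; rewrite /pvalid /psrc /=.
have [|ne] := boolP ((v1, s1 ++ s2) == (v, s)).
  rewrite xpair_eqE => /andP [/eqP -> /eqP <-]; rewrite andbT.
  have i0 : (size s1 < (size (s1 ++ s2)).+1)%N by rewrite size_cat ltnS leq_addr.
  rewrite (bigD1 (Ordinal i0)) //= big1 ?addr0; last first.
    move=> i /eqP ne; case: eqP => [[e1]|]; last by rewrite mul0r.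
    suff : i = Ordinal i0 by [].
    apply: val_inj => /=; move: (congr1 size e1); rewrite size_take.
    have := ltn_ord i; rewrite ltnS leq_eqVlt => /orP[/eqP ->|->]; rewrite ?ltnn //.
  rewrite /pdrop /ptake /= take_size_cat // drop_size_cat // eqxx mul1r xpair_eqE eqxx andbT.
  rewrite vpath_cat [v2 == _]eq_sym; case: eqP => [->|]; last by rewrite !andbF if_same.
  by rewrite andbT; case: ifP.
rewrite andbF; case: ifP => // _; rewrite big1 // => i _.
case: eqP => [[ev e1]|]; rewrite ?mul0r // mul1r.
case: eqP => [[_ e2]|] //; move/eqP: ne; case; by rewrite ev e1 e2 cat_take_drop.
Qed.

Lemma coef_kmul x y p : coef (kmul x y) p =
  if pvalid p then \sum_(i < (size p.2).+1) coef x (ptake i p) * coef y (pdrop i p) else 0.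
Proof.
have coefE z a : coef z a = \sum_(t <- z) t.1 * (t.2 == a)%:R.
  rewrite /coef big_mkcond; apply: eq_bigr => t _.
  by case: eqP; rewrite ?mulr1 ?mulr0.
rewrite /kmul coef_flatten.
transitivity (\sum_(t <- x) \sum_(u <- y) t.1 * u.1 * (if pvalid p then
      \sum_(i < (size p.2).+1) (t.2 == ptake i p)%:R * (u.2 == pdrop i p)%:R else 0)).
  apply: eq_bigr => t _; rewrite /coef big_map big_filter_cond big_mkcond /=.
  by apply: eq_bigr => u _; rewrite -split_indicator; case: ifP; rewrite ?mulr1 ?mulr0.
case: ifP => _; last first.
  by rewrite big1 // => t _; rewrite big1 // => u _; rewrite mulr0.
transitivity (\sum_(i < (size p.2).+1) \sum_(t <- x) \sum_(u <- y)
    t.1 * u.1 * ((t.2 == ptake i p)%:R * (u.2 == pdrop i p)%:R)).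
  rewrite [RHS]exchange_big; apply: eq_bigr => t _ /=.
  by rewrite [RHS]exchange_big; apply: eq_bigr => u _ /=; rewrite mulr_sumr.
apply: eq_bigr => i _; rewrite !coefE mulr_suml; apply: eq_bigr => t _.
rewrite mulr_sumr; apply: eq_bigr => u _; by rewrite mulrACA.
Qed.

(** Only the cut after [c] arrows contributes. The entries of all differentials below are supported
    in a single length, so this evaluates them. *)
Lemma coef_kmul_homog (c : nat) x y p : pvalid p ->
  (forall a, coef x a != 0 -> size a.2 = c) ->
  coef (kmul x y) p =
  if (c <= size p.2)%N then coef x (ptake c p) * coef y (pdrop c p) else 0.
Proof.
move=> vp hx; rewrite coef_kmul vp.
have x0 i : (i <= size p.2)%N -> i <> c -> coef x (ptake i p) = 0.
  move=> ip ic; apply/eqP; apply: contraT => /hx /=.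
  by rewrite size_takel // => /ic.
case: leqP => [cp|pc].
  have cp' : (c < (size p.2).+1)%N by [].
  rewrite (bigD1 (Ordinal cp')) //= big1 ?addr0 // => i /eqP ne.
  rewrite x0 ?mul0r // -1?ltnS //; by move=> e; case: ne; apply: val_inj.
rewrite big1 // => i _; rewrite x0 ?mul0r // -1?ltnS //.
by move=> e; move: (ltn_ord i); rewrite e ltnS leqNgt pc.
Qed.

(** Up to a scalar, this is the general summand in the definition of [in_ideal]. *)
Definition sandwich a r b : kq K Q := kmul (kmul (kpath K a) r) (kpath K b).

Lemma coef_sandwich a b r s :
  pvalid (a.1, a.2 ++ s ++ b.2) -> b.1 = ptgt (a.1, a.2 ++ s) ->
  coef (sandwich a r b) (a.1, a.2 ++ s ++ b.2) = coef r (ptgt a, s).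
Proof.
case: a b => v sa [w sb] /= vp ew; rewrite /sandwich coef_kmul vp /=.
have i0 : (size (sa ++ s) < (size (sa ++ s ++ sb)).+1)%N.
  by rewrite ltnS catA [leqRHS]size_cat leq_addr.
rewrite (bigD1 (Ordinal i0)) //= big1 ?addr0; last first.
  move=> i /eqP ne; rewrite coef_path; case: eqP; rewrite ?mulr0 // => -[_ e1].
  suff : i = Ordinal i0 by [].
  apply: val_inj => /=; move: (congr1 size e1) (ltn_ord i); rewrite size_drop /= ltnS.
  by move: (nat_of_ord i) => k; rewrite !size_cat; lia.
rewrite /pdrop /ptake /= catA take_size_cat // drop_size_cat // -ew coef_path eqxx mulr1.
move: vp; rewrite /pvalid /= catA vpath_cat => /andP [vp _].
rewrite (@coef_kmul_homog (size sa)) /= ?size_cat ?leq_addr //; last first.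
  by move=> a; rewrite coef_path; case: (altP (_ =P a)) => [<-|]; rewrite ?eqxx.
by rewrite /pdrop /ptake /= take_size_cat // drop_size_cat // coef_path eqxx mul1r.
Qed.

(** With [coef_sandwich] this determines all coefficients: the support consists of valid paths
    beginning with [a] and ending with [b], and the middle part carries the coefficient of [r]. *)
Lemma sandwichP a r b p : coef (sandwich a r b) p != 0 ->
  exists s, [/\ pvalid p, p = (a.1, a.2 ++ s ++ b.2) & b.1 = ptgt (a.1, a.2 ++ s)].
Proof.
rewrite /sandwich coef_kmul; case: ifP => [vp|]; rewrite ?eqxx // => ne.
have /existsP [i nei] :
    [exists i : 'I_(size p.2).+1, coef (kmul (kpath K a) r) (ptake i p) * coef (kpath K b) (pdrop i p) != 0].
  by apply: contraR ne => /existsPn h; rewrite big1 // => i _; apply/eqP/negPn/h.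
move: nei; rewrite mulf_eq0 negb_or => /andP [].
rewrite coef_path; case: (altP (b =P _)) => [eb|]; rewrite ?eqxx // => n1 _.
have vt : pvalid (ptake i p).
  by move: vp; rewrite /pvalid /= -{1}(cat_take_drop i p.2) vpath_cat => /andP [].
move: n1; rewrite (@coef_kmul_homog (size a.2)) //; last first.
  by move=> c; rewrite coef_path; case: (altP (_ =P c)) => [<-|]; rewrite ?eqxx.
case: ifP; rewrite ?eqxx // => la; rewrite mulf_eq0 negb_or => /andP [].
rewrite coef_path; case: (altP (a =P _)) => [ea|]; rewrite ?eqxx // => _ _.
exists (drop (size a.2) (take i p.2)).
have ea1 : a.1 = p.1 by rewrite ea.
have ea2 : a.2 ++ drop (size a.2) (take i p.2) = take i p.2.
  by rewrite {1}ea /= cat_take_drop.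
by rewrite catA ea1 ea2 eb /= cat_take_drop -surjective_pairing.
Qed.

Lemma coef_sandwich_nil a b p : coef (sandwich a [::] b) p = 0.
Proof.
apply/eqP; apply: contraT => ne; have [s [vp ep eb]] := sandwichP ne.
by move: vp ne; rewrite ep => vp; rewrite coef_sandwich // coef_nil eqxx.
Qed.

Lemma sandwich_path a b p : pvalid (a.1, a.2 ++ p.2 ++ b.2) -> p.1 = ptgt a ->
   b.1 = ptgt (a.1, a.2 ++ p.2) ->
  keq (sandwich a (kpath K p) b) (kpath K (a.1, a.2 ++ p.2 ++ b.2)).
Proof.
move=> vp ep eb c; rewrite coef_path.
have [e|ne] := altP (_ =P c); first by rewrite -e coef_sandwich // coef_path -ep -surjective_pairing eqxx.
apply/eqP; apply: contraNT ne => ne.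
have [s [vc ec ebs]] := sandwichP ne.
move: vc ne; rewrite ec => vc; rewrite coef_sandwich // coef_path.
by case: (altP (p =P _)) => [->|]; rewrite ?eqxx.
Qed.

End PathAlgebra.

(** * Ideals: closure properties, linear forms and normal forms *)

Section Ideal.
Variables (K : fieldType) (Q : quiver) (R : seq (kq K Q)).
Local Open Scope ring_scope.
Implicit Types (x y z r : kq K Q) (p a b : qpath Q).
Local Notation I := (in_ideal R).

Lemma in_ideal_keq x y : keq x y -> I x -> I y.
Proof. by move=> e [ts h]; exists ts => p; rewrite -e. Qed.

Lemma in_ideal0 : I [::].
Proof. by exists [::]. Qed.

Lemma in_ideal_add x y : I x -> I y -> I (x ++ y).
Proof.
move=> [ts h] [us g]; exists (ts ++ us) => p.
by rewrite map_cat flatten_cat !coef_cat h g.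
Qed.

Lemma in_ideal_scale c x : I x -> I (kscale c x).
Proof.
move=> [ts h]; exists [seq (c * t.1.1.1, t.1.1.2, t.1.2, t.2) | t <- ts] => p.
rewrite coef_scale h -map_comp !coef_flatten mulr_sumr; apply: eq_bigr => t _ /=.
by rewrite !coef_scale mulrA.
Qed.

Lemma in_ideal_flatten (T : eqType) (l : seq T) (F : T -> kq K Q) :
  (forall t, t \in l -> I (F t)) -> I (flatten [seq F t | t <- l]).
Proof.
elim: l => [|t l IH] h; first exact: in_ideal0.
apply: in_ideal_add; first by apply: h; rewrite mem_head.
by apply: IH => u ul; apply: h; rewrite in_cons ul orbT.
Qed.

Lemma in_ideal_sandwich a r b : r \in R -> I (sandwich a r b).
Proof.
move=> rR; exists [:: (1, a, index r R, b)] => p /=; rewrite cats0 coef_scale mul1r.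
by rewrite nth_index.
Qed.

(** A linear form reading finitely many coefficients kills the ideal once it kills all sandwiches of
    relations. Such forms serve to show that an element lies outside the ideal. *)
Lemma in_ideal_form (T : finType) (wt : T -> K) (P : T -> qpath Q) x :
  (forall a r b, r \in R -> \sum_t wt t * coef (sandwich a r b) (P t) = 0) ->
  I x -> \sum_t wt t * coef x (P t) = 0.
Proof.
move=> h [ts e].
under eq_bigr => t _ do rewrite e coef_flatten mulr_sumr.
rewrite exchange_big big1 //= => t _.
under eq_bigr => u _ do rewrite coef_scale mulrCA.
(* An index beyond the list of relations denotes the empty sum, whose sandwich is zero. *)
rewrite -mulr_sumr; have [ti|ti] := ltnP t.1.2 (size R).
  by rewrite h ?mulr0 // mem_nth.
rewrite big1 ?mulr0 // => u _; rewrite nth_default //.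
by rewrite [coef _ _](@coef_sandwich_nil K Q t.1.1.2 t.2) mulr0.
Qed.

Lemma in_ideal_coef0 x p :
  (forall a r b, r \in R -> coef (sandwich a r b) p = 0) -> I x -> coef x p = 0.
Proof.
move=> h Ix; have := @in_ideal_form unit (fun _ => 1) (fun _ => p) x _ Ix.
rewrite big_const card_unit /= mul1r addr0; apply=> a r b rR.
by rewrite big_const card_unit /= mul1r addr0 h.
Qed.

Lemma in_ideal_invalid x p : I x -> ~~ pvalid p -> coef x p = 0.
Proof.
move=> Ix vp; apply: in_ideal_coef0 Ix => a r b _; apply/eqP.
by apply: contraNT vp => /sandwichP [s []].
Qed.

Lemma in_ideal_path a b p : kpath K p \in R ->
  pvalid (a.1, a.2 ++ p.2 ++ b.2) -> p.1 = ptgt a -> b.1 = ptgt (a.1, a.2 ++ p.2) ->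
  I (kpath K (a.1, a.2 ++ p.2 ++ b.2)).
Proof.
by move=> pR vp ep eb; apply: in_ideal_keq (in_ideal_sandwich a b pR); apply: sandwich_path.
Qed.

(** With the coefficients of x, split x into a combination of the differences p - N(p) and one of
    the N(p). The first lies in the ideal term by term, the second is zero by the last
    hypothesis. *)
Lemma in_ideal_normal (N : qpath Q -> kq K Q) x :
  (forall p, pvalid p -> I (ksub (kpath K p) (N p))) ->
  (forall p, ~~ pvalid p -> coef x p = 0) ->
  (forall p, \sum_(a <- undup [seq t.2 | t <- x]) coef x a * coef (N a) p = 0) ->
  I x.
Proof.
move=> hN hv hx; set l := undup _ in hx.
have : I (flatten [seq kscale (coef x a) (ksub (kpath K a) (N a)) | a <- l]).
  apply: in_ideal_flatten => a _; have [va|/hv ->] := boolP (pvalid a).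
    exact/in_ideal_scale/hN.
  by apply: in_ideal_keq in_ideal0 => p; rewrite coef_scale mul0r coef_nil.
apply: in_ideal_keq => p; rewrite coef_flatten.
under eq_bigr => a _ do rewrite coef_scale coef_sub mulrBr.
rewrite sumrB hx subr0.
under eq_bigr => a _ do rewrite coef_path.
have [pl|pl] := boolP (p \in l).
  rewrite (big_rem p) //= eqxx mulr1 big_seq big1 ?addr0 // => a.
  by rewrite mem_rem_uniq ?undup_uniq // inE => /andP [/negPf -> _]; rewrite mulr0.
rewrite big_seq big1; last first.
  by move=> a al; case: eqP => [e|]; rewrite ?mulr0 //; move: pl; rewrite -e al.
by apply/esym/eqP; apply: contraNT pl => /coef_neq0_mem; rewrite mem_undup.
Qed.

End Ideal.

(** * Graded resolutions given by indexed families *)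

Section Family.
Variables (K : fieldType) (A : pres K).
Local Notation Q := (pQ A).
Variables (T : eqType) (idx : nat -> seq T) (vt : nat -> T -> qV Q) (dg : nat -> nat).
Variable (m : nat -> T -> T -> kq K Q).
Local Open Scope ring_scope.
Hypothesis idx_uniq : forall n, uniq (idx n).

(** Elements of the projectives are functions on an index type here, not lists aligned with
    positions: [felt] and [dfam] are the counterparts of [pelt] and [dmap], and the lemmas up to
    [fam_res] translate exactness between the two forms. *)
Definition felt n (X : T -> kq K Q) :=
  forall t p, t \in idx n -> coef (X t) p != 0 -> pvalid p /\ psrc p = vt n t.

Definition dfam n (X : T -> kq K Q) (i : T) : kq K Q :=
  flatten [seq kmul (m n i j) (X j) | j <- idx n].

Lemma coef_dfam n X i p :
  coef (dfam n X i) p = (\sum_(j <- idx n) coef (kmul (m n i j) (X j)) p).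
Proof. exact: coef_flatten. Qed.

Lemma coef_dfam_invalid n X i p : ~~ pvalid p -> coef (dfam n X i) p = 0%R.
Proof. by move=> /negPf vp; rewrite coef_dfam big1 // => j _; rewrite coef_kmul vp. Qed.
Definition fgen n : seq (qV Q * nat) := [seq (vt n t, dg n) | t <- idx n].

Definition fmat n k l : kq K Q :=
  match onth (idx n.-1) k, onth (idx n) l with
  | Some i, Some j => m n i j
  | _, _ => [::]
  end.

Lemma onth_fgen n k v e : onth (fgen n) k = Some (v, e) ->
  exists t, [/\ onth (idx n) k = Some t, v = vt n t & e = dg n].
Proof. by rewrite /fgen onth_map; case: (onth _ _) => //= t [<- <-]; exists t. Qed.

Lemma pelt_felt n (x : seq (kq K Q)) :
  pelt fgen n x -> felt n (fun t => nth [::] x (index t (idx n))).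
Proof.
move=> [sz h] t p tn ne; have lt : (index t (idx n) < size x)%N.
  by rewrite sz size_map index_mem.
apply: (h (index t (idx n)) _ _ (dg n) p _ _ ne).
  by rewrite onthE (nth_map [::]).
by rewrite onth_map onthE (nth_map t) ?index_mem // nth_index.
Qed.

Lemma felt_pelt n X : felt n X -> pelt fgen n [seq X t | t <- idx n].
Proof.
move=> h; split; first by rewrite !size_map.
move=> l xl vl dl p; rewrite onth_map => + /onth_fgen [t [e -> _]].
by rewrite e /= => -[<-]; apply: h; apply/onthP; exists l.
Qed.

Lemma dmap_fam n (x : seq (kq K Q)) X i : i \in idx n ->
  (forall t, t \in idx n.+1 -> nth [::] x (index t (idx n.+1)) = X t) ->
  nth [::] (dmap fgen fmat n.+1 x) (index i (idx n)) = dfam n.+1 X i.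
Proof.
move=> im h; rewrite /dmap nth_mkseq ?size_map ?index_mem //.
congr flatten; rewrite /mkseq.
have -> : iota 0 (size (idx n.+1)) = [seq index j (idx n.+1) | j <- idx n.+1].
  apply: (@eq_from_nth _ 0%N); first by rewrite size_iota size_map.
  move=> k; rewrite size_iota => kl; rewrite nth_iota // add0n.
  have [t0 _] : exists t, t \in idx n.+1.
    by case: (idx n.+1) kl => // t *; exists t; rewrite mem_head.
  by rewrite (nth_map t0) // index_uniq.
rewrite -map_comp; apply/eq_in_map => j jm /=; rewrite (h _ jm) /fmat /=.
by rewrite !onthE !(nth_map i) ?index_mem // !nth_index.
Qed.

Hypothesis gen0 : [seq vt 0 t | t <- idx 0] = enum (qV Q).
Hypothesis dg0 : dg 0 = 0%N.
Hypothesis m_arrow : forall n i j p, i \in idx n -> j \in idx n.+1 ->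
  coef (m n.+1 i j) p != 0 ->
  [/\ pvalid p, psrc p = vt n i, ptgt p = vt n.+1 j, (0 < size p.2)%N
    & (dg n + size p.2)%N = dg n.+1].
Local Notation I := (in_ideal (prel A)).
Hypothesis fexact0 : forall X, felt 0 X ->
  ((forall i, i \in idx 0 -> coef (X i) (vt 0 i, [::]) = 0) <->
   exists Y, felt 1 Y /\ forall i, i \in idx 0 -> I (ksub (dfam 1 Y i) (X i))).
Hypothesis fexact : forall n X, felt n.+1 X ->
  ((forall i, i \in idx n -> I (dfam n.+1 X i)) <->
   exists Y, felt n.+2 Y /\ forall i, i \in idx n.+1 -> I (ksub (dfam n.+2 Y i) (X i))).

Lemma fam_kP n k : (k < size (fgen n))%N ->
  exists2 t, t \in idx n & k = index t (idx n).
Proof.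
rewrite size_map => kn; have [t0 _] : exists t, t \in idx n.
  by case: (idx n) kn => // t *; exists t; rewrite mem_head.
by exists (nth t0 (idx n) k); rewrite ?mem_nth // index_uniq.
Qed.

Lemma fam_kS n t : t \in idx n -> (index t (idx n) < size (fgen n))%N.
Proof. by rewrite size_map index_mem. Qed.

Lemma fam_image n (x : seq (kq K Q)) : size x = size (fgen n) ->
  ((exists Y, felt n.+1 Y /\ forall i, i \in idx n ->
      I (ksub (dfam n.+1 Y i) (nth [::] x (index i (idx n))))) <->
   exists y, pelt fgen n.+1 y /\ forall k, (k < size (fgen n))%N ->
      I (ksub (nth [::] (dmap fgen fmat n.+1 y) k) (nth [::] x k))).
Proof.
move=> sx; split=> [[Y [fY hY]]|[y [py hy]]].
  exists [seq Y t | t <- idx n.+1]; split; first exact: felt_pelt.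
  move=> k /fam_kP [t tn ->]; rewrite (@dmap_fam n _ Y) //; first exact: hY.
  by move=> u um; rewrite (nth_map u) ?index_mem // nth_index.
exists (fun t => nth [::] y (index t (idx n.+1))); split; first exact: pelt_felt.
by move=> i im; have := hy _ (fam_kS im); rewrite (dmap_fam im (fun _ _ => erefl)).
Qed.

Lemma fam_res : min_graded_res fgen fmat.
Proof.
split.
- rewrite /fgen dg0 -gen0 -map_comp; exact: eq_map.
- move=> n k l vk dk vl dl p /onth_fgen [i [ei -> ->]] /onth_fgen [j [ej -> ->]].
  rewrite /fmat /= ei ej; apply: m_arrow; apply/onthP; [by exists k | by exists l].
- move=> x px; rewrite -(fam_image px.1).
  rewrite -(fexact0 (pelt_felt px)); split=> h.
    move=> i im; apply: (h (index i (idx 0)) _ _ 0%N).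
      by rewrite onthE (nth_map [::]) // px.1 fam_kS.
    by rewrite onth_map onthE (nth_map i) ?index_mem // nth_index //= dg0.
  move=> l xl v dv ex /onth_fgen [t [et -> _]].
  have tm : t \in idx 0 by apply/onthP; exists l.
  have el : index t (idx 0) = l.
    move: et; rewrite onthE; have [ll|ll] := ltnP l (size (idx 0)); last first.
      by rewrite nth_default // size_map.
    by rewrite (nth_map t) // => -[<-]; rewrite index_uniq.
  have := h t tm; rewrite el; move: ex; rewrite onthE.
  have [ll|ll] := ltnP l (size x); last by rewrite nth_default // size_map.
  by rewrite (nth_map [::]) // => -[->].
move=> n x px; rewrite -(fam_image px.1) -(fexact (pelt_felt px)); split=> h.
  by move=> i im; have := h _ (fam_kS im); rewrite (dmap_fam im (fun _ _ => erefl)).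
by move=> k /fam_kP [t tn ->]; rewrite (dmap_fam tn (fun _ _ => erefl)); apply: h.
Qed.

End Family.

(** * Truncated path algebras of oriented cycles *)

Section Serial.
Variables (K : fieldType) (A : pres K).
Local Notation Q := (pQ A).
Local Notation I := (in_ideal (prel A)).
Variables (out : qV Q -> qA Q) (d : nat).
Hypothesis qs_out : cancel out (@qs Q).
Hypothesis out_qs : cancel (@qs Q) out.
(** Each vertex has exactly one outgoing arrow [out v]. With [nx] injective the quiver is a disjoint
    union of oriented cycles, and the ideal consists of the combinations of valid paths of length at
    least [d]. *)
Definition nx (v : qV Q) : qV Q := qt (out v).
Hypothesis nx_inj : injective nx.
Hypothesis d_gt1 : 1 < d.
Hypothesis idealE : forall x, I x <->
  (forall p, pvalid p -> size p.2 < d -> coef x p = 0%R) /\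
  (forall p, ~~ pvalid p -> coef x p = 0%R).
Local Open Scope ring_scope.

Fixpoint spath (v : qV Q) n : seq (qA Q) :=
  if n is n'.+1 then out v :: spath (nx v) n' else [::].

Local Notation P v n := ((v, spath v n) : qpath Q).

Lemma size_spath v n : size (spath v n) = n.
Proof. by elim: n v => //= n IH v; rewrite IH. Qed.

Lemma ptgt_spath v n : ptgt (P v n) = iter n nx v.
Proof.
by elim: n v => // n IH v; rewrite iterSr -IH.
Qed.

Lemma pvalid_spath v n : pvalid (P v n).
Proof. by rewrite /pvalid /=; elim: n v => //= n IH v; rewrite qs_out eqxx; apply: IH. Qed.

Lemma pvalid_spathE p : pvalid p -> p = P p.1 (size p.2).
Proof.
case: p => v s; rewrite /pvalid /= => vs; congr (_, _).
by elim: s v vs => //= a s IH v /andP [/eqP <- /IH e]; rewrite /nx out_qs -e.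
Qed.

Lemma take_spath v n k : (k <= n)%N -> take k (spath v n) = spath v k.
Proof. by elim: n v k => [|n IH] v [|k] //= kn; rewrite IH. Qed.

Lemma drop_spath v n k : (k <= n)%N -> drop k (spath v n) = spath (iter k nx v) (n - k).
Proof.
by elim: n v k => [|n IH] v [|k] // kn; rewrite iterSr -IH.
Qed.

(* the length of the (unique) path that the n-th differential multiplies by *)
Definition slen n := if odd n then d.-1 else 1%N.

Definition smat n (v w : qV Q) : kq K Q :=
  if iter (slen n.-1) nx v == w then kpath K (P v (slen n.-1)) else [::].

Local Notation idx := (fun _ : nat => enum (qV Q)).
Local Notation vt := (fun (_ : nat) (v : qV Q) => v).
Local Notation D := (dfam idx smat).

(** Left multiplication by a path is a shift: the coefficient at a path from [v] is read off after
    removing its first [slen n] arrows. *)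
Lemma coef_dserial n X v u j :
  coef (D n.+1 X v) (P u j) =
  if (u == v) && (slen n <= j)%N
  then coef (X (iter (slen n) nx v)) (P (iter (slen n) nx v) (j - slen n)) else 0.
Proof.
rewrite coef_dfam (bigD1_seq (iter (slen n) nx v)) ?mem_enum ?enum_uniq //=.
rewrite /smat /= eqxx big1 ?addr0; last first.
  move=> i /negPf ne; rewrite eq_sym ne coef_kmul; case: ifP => // _.
  by rewrite big1 // => k _; rewrite coef_nil mul0r.
rewrite (@coef_kmul_homog _ _ (slen n)) ?pvalid_spath //; last first.
  by move=> a; rewrite coef_path; case: (altP (_ =P a)) => [<- /=|]; rewrite ?size_spath ?eqxx.
rewrite /= size_spath andbC; case: leqP => //= le.
rewrite /pdrop /ptake /= take_spath // coef_path xpair_eqE [v == u]eq_sym.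
have [->|ne] := eqVneq u v; last by rewrite mul0r.
by rewrite eqxx mul1r drop_spath // ptgt_spath.
Qed.

Lemma iter_nx_bij n : bijective (iter n nx).
Proof.
by apply: injF_bij; elim: n => [|n IH] x y //= /nx_inj /IH.
Qed.

(** A coefficient at length j is moved to length j + [slen n] and disappears in the quotient exactly
    when this is at least [d]. Every [w] is reached because [nx] is bijective. *)
Lemma serial_ker n X :
  (forall v, I (D n.+1 X v)) <->
  (forall w j, (j + slen n < d)%N -> coef (X w) (P w j) = 0).
Proof.
split=> [h w j jd|h v].
  have [g gK Kg] := iter_nx_bij (slen n).
  have [/(_ (P (g w) (j + slen n)) (pvalid_spath _ _)) + _] := (idealE _).1 (h (g w)).
  by rewrite coef_dserial size_spath jd eqxx leq_addl Kg addnK; apply.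
apply/idealE; split=> p vp; last exact: coef_dfam_invalid.
rewrite (pvalid_spathE vp) /= size_spath => sp; rewrite coef_dserial.
case: ifP => // /andP [_ le]; rewrite h //; lia.
Qed.

Lemma slen_lt n : (slen n < d)%N.
Proof. rewrite /slen; case: ifP; lia. Qed.

(** Paths of length at least [slen n] can be divided on the left by the path that the differential
    multiplies by. Since [slen n] is less than [d], shorter lengths are not affected by the
    ideal. *)
Lemma serial_im n X : felt idx vt n X ->
  (exists Y, felt idx vt n.+1 Y /\ forall v, I (ksub (D n.+1 Y v) (X v))) <->
  (forall w j, (j < slen n)%N -> coef (X w) (P w j) = 0).
Proof.
move=> fX; have Xv v p : coef (X v) p != 0 -> pvalid p /\ psrc p = v.
  by move=> ne; apply: fX; rewrite ?mem_enum.
split=> [[Y [fY h]] w j jc|h].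
  have := (((idealE _).1 (h w)).1 (P w j) (pvalid_spath _ _)).
  rewrite size_spath => /(_ (ltn_trans jc (slen_lt _))).
  rewrite coef_sub coef_dserial leqNgt jc andbF sub0r => /eqP.
  by rewrite oppr_eq0 => /eqP.
have [g gK Kg] := iter_nx_bij (slen n).
(* The preimage drops the first [slen n] arrows; [g w] is the vertex from which the dropped path
   leads to [w]. Lengths from [d] on may be ignored modulo the ideal. *)
pose Y w : kq K Q := flatten [seq kscale (coef (X (g w)) (P (g w) (slen n + j)))
                                   (kpath K (P w j)) | j <- iota 0 d].
have cY w p : coef (Y w) p = \sum_(j <- iota 0 d)
     coef (X (g w)) (P (g w) (slen n + j)) * (P w j == p)%:R.
  by rewrite coef_flatten; apply: eq_bigr => j _; rewrite coef_scale coef_path.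
exists Y; split.
  move=> w p _ ne; suff /existsP [j /eqP <-] : [exists j : 'I_d, P w j == p].
    by rewrite pvalid_spath.
  apply: contraR ne => /existsPn h'; rewrite cY big_seq big1 // => j.
  rewrite mem_iota add0n => /andP [_ jd]; have := h' (Ordinal jd).
  by move=> /negPf /= ->; rewrite mulr0.
move=> v; apply/idealE; split=> p vp; last first.
  rewrite coef_sub coef_dfam_invalid // sub0r; apply/eqP; rewrite oppr_eq0.
  by apply: contraNT vp => /Xv [].
rewrite (pvalid_spathE vp) /= size_spath coef_sub coef_dserial.
move: p.1 (size p.2) => u j jd.
have [->|ne] /= := eqVneq u v; last first.
  rewrite sub0r; apply/eqP; rewrite oppr_eq0; apply: contraNT ne.
  by move=> /Xv [_ <-].
case: leqP => [le|lt]; last by rewrite h ?subr0.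
rewrite cY (bigD1_seq (j - slen n)%N) ?mem_iota ?iota_uniq //=; last first.
  exact: leq_ltn_trans (leq_subr _ _) jd.
rewrite eqxx mulr1 gK subnKC // big1 ?addr0 ?subrr // => i /eqP ne.
case: eqP => [[/(congr1 size)]|]; rewrite ?mulr0 // !size_spath => /ne [].
Qed.

Lemma serial_res : exists gen mat, @min_graded_res K A gen mat /\
    forall n g, g \in gen n -> g.2 = delta d n.
Proof.
exists (fgen idx vt (delta d)), (fmat idx smat); split; last first.
  by move=> n g /mapP [v _ ->].
(* The kernel of one differential is cut out by lengths below [d - slen n], the image of the next by
   lengths below [slen n.+1]; these bounds agree. *)
have slenD n : (slen n + slen n.+1 = d)%N by rewrite /slen /=; case: (odd n) => /=; lia.
apply: fam_res => //.
- by move=> _; exact: enum_uniq.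
- exact: map_id.
- move=> n v w p _ _; rewrite /smat /=; case: (altP (iter _ _ v =P w)) => [<-|_]; last by rewrite coef_nil eqxx.
  rewrite coef_path; case: (altP (_ =P p)) => [<- _|]; rewrite ?eqxx //.
  rewrite pvalid_spath ptgt_spath /= size_spath; split=> //.
    by rewrite /slen; case: ifP; lia.
  rewrite /delta /slen /= uphalf_half; case: (odd n) => /=; nia.
- move=> X fX; split=> [h|[Y [fY h]] v _].
    have /(serial_im fX) [Y [fY hY]] : forall w j, (j < slen 0)%N -> coef (X w) (P w j) = 0.
      by move=> w [|j] // _; apply: h; rewrite mem_enum.
    by exists Y; split.
  apply: ((serial_im fX).1 _ v 0%N isT); exists Y; split=> // w; apply: h.
  by rewrite mem_enum.
- move=> n X fX; split=> [h|[Y [fY h]] v _].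
    have /(serial_im fX) [Y [fY hY]] : forall w j, (j < slen n.+1)%N -> coef (X w) (P w j) = 0.
      move=> w j jn; apply: ((@serial_ker n X).1); first by move=> v; apply: h; rewrite mem_enum.
      by rewrite -(slenD n); lia.
    by exists Y; split.
  apply: ((@serial_ker n X).2) => w j jn; apply: (serial_im fX).1.
    by exists Y; split=> // u; apply: h; rewrite mem_enum.
  by move: jn; rewrite -{1}(slenD n); lia.
Qed.

End Serial.

(** * The Koszul resolution in the quadratic case without truncated edges *)

Lemma delta2 n : delta 2 n = n.
Proof. by rewrite /delta -[in RHS](odd_double_half n) -muln2; case: (odd n) => /=; lia. Qed.

Section Linear.
Variables (K : fieldType) (Q : quiver) (sg : qA Q -> qA Q) (kap : qA Q -> K).
Hypothesis qt_sg : forall a, qs (sg a) = qt a.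
Local Open Scope ring_scope.

(* the coefficient of x at the socle of the projective at v *)
Definition socle_coef (x : kq K Q) v : K := \sum_(a | qs a == v) kap a * coef x (v, [:: a; sg a]).

Local Notation soc := socle_coef.

Lemma soc_sub x y v : soc (ksub x y) v = soc x v - soc y v.
Proof. by rewrite /socle_coef -sumrB; apply: eq_bigr => a _; rewrite coef_sub mulrBr. Qed.

Lemma soc_flatten (T : Type) (l : seq T) (F : T -> kq K Q) v :
  soc (flatten [seq F t | t <- l]) v = \sum_(t <- l) soc (F t) v.
Proof.
rewrite /socle_coef exchange_big /=; apply: eq_bigr => a _.
by rewrite coef_flatten mulr_sumr.
Qed.

Lemma pvalid1 a : pvalid ((qs a, [:: a]) : qpath Q).
Proof. by rewrite /pvalid /= eqxx. Qed.

Lemma pvalid_soc a : pvalid ((qs a, [:: a; sg a]) : qpath Q).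
Proof. by rewrite /pvalid /= qt_sg !eqxx. Qed.

Variables (f : kq K Q) (v : qV Q).
Hypothesis f1 : forall p, coef f p != 0 -> size p.2 = 1%N.

Lemma coef_linmul0 x w : coef (kmul f x) (w, [::]) = 0.
Proof. by rewrite (coef_kmul_homog (c := 1)). Qed.

Lemma coef_linmul1 x a :
  coef (kmul f x) (qs a, [:: a]) = coef f (qs a, [:: a]) * coef x (qt a, [::]).
Proof. by rewrite (coef_kmul_homog (c := 1)) // pvalid1. Qed.

Lemma soc_linmul x w :
  soc (kmul f x) w = \sum_(a | qs a == w) kap a * coef f (w, [:: a]) * coef x (qt a, [:: sg a]).
Proof.
apply: eq_bigr => a /eqP <-.
by rewrite (coef_kmul_homog (c := 1)) ?pvalid_soc //= mulrA.
Qed.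
End Linear.

Section Koszul.
Variables (K : fieldType) (A : pres K).
Local Notation Q := (pQ A).
Local Notation I := (in_ideal (prel A)).
Variables (sg tau : qA Q -> qA Q) (kap : qA Q -> K) (r0 : qV Q -> qA Q).
Hypothesis qt_sg : forall a, qs (sg a) = qt a.
Hypothesis sgK : involutive sg.
Hypothesis tauK : involutive tau.
Hypothesis qs_tau : forall a, qs (tau a) = qs a.
Hypothesis tau_neq : forall a, tau a != a.
Hypothesis tau_total : forall a b, qs a = qs b -> b = a \/ b = tau a.
Hypothesis qs_r0 : cancel r0 (@qs Q).
Local Open Scope ring_scope.
Hypothesis kap_neq0 : forall a, kap a != 0.
Hypothesis idealE : forall x, I x <->
  [/\ forall p, ~~ pvalid p -> coef x p = 0,
      forall p, pvalid p -> (size p.2 < 2)%N -> coef x p = 0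
    & forall v, socle_coef sg kap x v = 0].
Local Notation soc := (socle_coef sg kap).

Lemma big_qs (F : qA Q -> K) a : \sum_(b | qs b == qs a) F b = F a + F (tau a).
Proof.
rewrite (bigD1 a) //= (bigD1 (tau a)) /= ?qs_tau ?eqxx ?tau_neq //.
rewrite big1 ?addr0 // => b /andP [/andP [/eqP e n1] n2].
by case: (tau_total (esym e)) n1 n2 => ->; rewrite eqxx.
Qed.

(* The walk in the universal cover: from the half-edge r0 s take i steps to the
   right and j steps to the left.  The generators of the n-th projective are the
   pairs (s, i) with i <= n, and j = n - i. *)
Definition pos s i j := iter i (tau \o sg) (iter j (sg \o tau) (r0 s)).

Lemma posSl s i j : pos s i.+1 j = tau (sg (pos s i j)).
Proof. by []. Qed.

Lemma posSr s i j : pos s i j.+1 = sg (tau (pos s i j)).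
Proof.
rewrite /pos /=; elim: i => //= i IH.
by rewrite IH !(sgK, tauK).
Qed.

(** Right and left steps are inverse to each other, so the position depends only on i - j. *)
Lemma posSS s i j : pos s i.+1 j.+1 = pos s i j.
Proof. by rewrite posSl posSr sgK tauK. Qed.

(* Right steps have coefficient 1; the coefficients of the left steps make the two
   ways around each square of the cover cancel modulo the relations of type one. *)
Fixpoint lam s i j : K :=
  if i is i'.+1
  then - lam s i' j * kap (tau (pos s i j)) / kap (pos s i j) else 1.

Lemma lamS s i j :
  lam s i.+1 j = - lam s i j * kap (tau (pos s i.+1 j)) / kap (pos s i.+1 j).
Proof. by []. Qed.

Definition kidx n : seq (qV Q * nat) := [seq (s, i) | s <- enum (qV Q), i <- iota 0 n.+1].
Definition kvt n (t : qV Q * nat) : qV Q := qs (pos t.1 t.2 (n - t.2)).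
(** At the generator (s, i) of degree n - 1 the arrow [r] leads right to the generator (s, i + 1) of
    degree n, and [tau r] leads left to (s, i), where j has grown by one. *)
Definition kmat n (k l : qV Q * nat) : kq K Q :=
  let r := pos k.1 k.2 (n.-1 - k.2) in
  if l == (k.1, k.2.+1) then kpath K (qs r, [:: r])
  else if l == k then kscale (lam k.1 k.2 (n - k.2)) (kpath K (qs r, [:: tau r]))
  else [::].

Lemma mem_kidx n s i : ((s, i) \in kidx n) = (i <= n)%N.
Proof.
apply/allpairsP/idP => [[p [_ + [_ ->]]]|le]; first by rewrite mem_iota.
by exists (s, i); rewrite mem_enum mem_iota.
Qed.

Lemma kidx_uniq n : uniq (kidx n).
Proof.
by apply: allpairs_uniq; rewrite ?enum_uniq ?iota_uniq // => -[? ?] [? ?] _ _ /= [-> ->].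
Qed.

Lemma kmatR n s i : let r := pos s i (n.-1 - i) in
  kmat n (s, i) (s, i.+1) = kpath K (qs r, [:: r]).
Proof. by rewrite /kmat eqxx. Qed.

Lemma kmatL n s i : let r := pos s i (n.-1 - i) in
  kmat n (s, i) (s, i) = kscale (lam s i (n - i)) (kpath K (qs r, [:: tau r])).
Proof. by rewrite /kmat eqxx xpair_eqE eqxx ltn_eqF. Qed.

Lemma kmat_lin n k l p : coef (kmat n k l) p != 0 -> size p.2 = 1%N.
Proof.
rewrite /kmat; case: ifP => _; last case: ifP => _; rewrite ?coef_nil ?eqxx //.
  by rewrite coef_path; case: (altP (_ =P p)) => [<-|]; rewrite ?eqxx.
by rewrite coef_scale coef_path; case: (altP (_ =P p)) => [<-|]; rewrite ?mulr0 ?eqxx.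
Qed.

Local Notation D := (dfam kidx kmat).

Lemma big_kidx n s i (F : qV Q * nat -> K) : (i <= n)%N ->
  (forall l, l != (s, i.+1) -> l != (s, i) -> F l = 0) ->
  \sum_(l <- kidx n.+1) F l = F (s, i.+1) + F (s, i).
Proof.
move=> le h; rewrite (bigD1_seq (s, i.+1)) ?kidx_uniq ?mem_kidx //=.
rewrite -big_filter (bigD1_seq (s, i)) ?filter_uniq ?kidx_uniq //=; last first.
  by rewrite mem_filter mem_kidx ltnW // xpair_eqE eqxx ltn_eqF.
by rewrite big_filter_cond big1 ?addr0 // => l /andP [n1 n2]; apply: h.
Qed.

Section Comp.
Variables (n : nat) (X : qV Q * nat -> kq K Q).

(** The coordinates of a component modulo the ideal: vertex, right arrow, left arrow, socle. The
    differential carries the first to the next two, and these to the last. *)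
Definition c0 (t : qV Q * nat) := coef (X t) (kvt n t, [::]).
Definition cR (t : qV Q * nat) := coef (X t) (kvt n t, [:: pos t.1 t.2 (n - t.2)]).
Definition cL (t : qV Q * nat) := coef (X t) (kvt n t, [:: tau (pos t.1 t.2 (n - t.2))]).
Definition cS (t : qV Q * nat) := soc (X t) (kvt n t).

(** The left coordinate at (s, i + 1) and the right one at (s, i) cancel in the socle at the
    generator (s, i) one degree lower. *)
Definition comp_rel s i : Prop := let r := pos s i (n.-1 - i) in
  kap r * cL (s, i.+1) + kap (tau r) * lam s i (n - i) * cR (s, i) = 0.
End Comp.

Lemma D0 n X t : c0 n (D n.+1 X) t = 0.
Proof.
rewrite /c0 coef_dfam big1 // => l _; rewrite coef_linmul0 //; exact: kmat_lin.
Qed.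

Lemma DR n X s i : (i <= n)%N -> cR n (D n.+1 X) (s, i) = c0 n.+1 X (s, i.+1).
Proof.
move=> le; rewrite /cR /kvt coef_dfam (big_kidx (s := s) (i := i)) //=; last first.
  move=> l /negPf n1 /negPf n2; rewrite coef_linmul1; last exact: kmat_lin.
  by rewrite /kmat n1 n2 coef_nil mul0r.
rewrite !coef_linmul1; try exact: kmat_lin.
rewrite kmatR kmatL coef_scale !coef_path eqxx.
rewrite xpair_eqE eqxx /= eqseq_cons (negPf (tau_neq _)) mulr0 mul0r addr0 mul1r.
by rewrite /c0 /kvt /= subSS qs_tau qt_sg.
Qed.

Lemma DL n X s i : (i <= n)%N ->
  cL n (D n.+1 X) (s, i) = lam s i (n.+1 - i) * c0 n.+1 X (s, i).
Proof.
move=> le; rewrite /cL /kvt -qs_tau coef_dfam (big_kidx (s := s) (i := i)) //=; last first.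
  move=> l /negPf n1 /negPf n2; rewrite coef_linmul1; last exact: kmat_lin.
  by rewrite /kmat n1 n2 coef_nil mul0r.
rewrite !coef_linmul1; try exact: kmat_lin.
rewrite kmatR kmatL coef_scale !coef_path qs_tau eqxx.
rewrite xpair_eqE eqxx /= eqseq_cons eq_sym (negPf (tau_neq _)) mul0r add0r mulr1.
by rewrite /c0 /kvt /= subSn // posSr qt_sg.
Qed.

Lemma DS n X s i : (i <= n)%N -> let r := pos s i (n - i) in
  cS n (D n.+1 X) (s, i) =
  kap r * cL n.+1 X (s, i.+1) + kap (tau r) * lam s i (n.+1 - i) * cR n.+1 X (s, i).
Proof.
move=> le r; rewrite /cS /kvt /= -/r soc_flatten (big_kidx (s := s) (i := i)) //=; last first.
  move=> l /negPf n1 /negPf n2; rewrite soc_linmul //; last exact: kmat_lin.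
  by rewrite /kmat n1 n2 big1 // => a _; rewrite coef_nil mulr0 mul0r.
rewrite !soc_linmul //; try exact: kmat_lin.
rewrite !big_qs kmatR kmatL !coef_scale !coef_path -/r eqxx.
rewrite !xpair_eqE !eqxx /= !eqseq_cons eq_sym (negPf (tau_neq _)) /=.
rewrite !mulr0 !mul0r addr0 add0r !mulr1.
rewrite /cL /cR /kvt [(_, _).1]/= [(_, _).2]/= subSS subSn // posSr posSl -/r tauK.
by rewrite qs_tau !qt_sg.
Qed.

Definition at_vertex v (x : kq K Q) := forall p, coef x p != 0 -> pvalid p /\ psrc p = v.

Lemma at_vertex_sub v x y : at_vertex v x -> at_vertex v y -> at_vertex v (ksub x y).
Proof.
move=> hx hy p; rewrite coef_sub; have [-> | /hx //] := eqVneq (coef x p) 0.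
by rewrite sub0r oppr_eq0 => /hy.
Qed.

(** Modulo the ideal the right projective at a vertex is four-dimensional: the paths [[:: a; sg a]]
    from it agree up to scalars, and all other paths of length at least two vanish. *)
Lemma ideal_at a x : at_vertex (qs a) x ->
  I x <-> [/\ coef x (qs a, [::]) = 0, coef x (qs a, [:: a]) = 0,
              coef x (qs a, [:: tau a]) = 0 & soc x (qs a) = 0].
Proof.
move=> xa; rewrite idealE; split=> [[h1 h2 h3]|[h0 hR hL hS]].
  by split=> //; apply: h2; rewrite // /pvalid /= ?qs_tau ?eqxx.
have z p : (pvalid p -> psrc p = qs a -> coef x p = 0) -> coef x p = 0.
  by move=> h; apply/eqP; apply: contraT => ne; have [vp ep] := xa _ ne; rewrite h ?eqxx in ne.
split=> [p /negPf vp|[v [|b [|c s]]] vp //= _|v].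
- by apply: z; rewrite vp.
- by apply: z => _ /= ->.
- apply: z => _; rewrite /psrc /= => ev; move: vp; rewrite ev /pvalid /= andbT => /eqP eb.
  by case: (tau_total (esym eb)) => ->.
- have [<- //|ne] := eqVneq (qs a) v.
  rewrite /socle_coef big1 // => b eb; rewrite z ?mulr0 // => _ e; by rewrite -e eqxx in ne.
Qed.

Lemma felt_at n X t : felt kidx kvt n X -> t \in kidx n -> at_vertex (kvt n t) (X t).
Proof. by move=> h tn p; apply: h. Qed.

Lemma D_at n X t : at_vertex (kvt n t) (D n.+1 X t).
Proof.
move=> p ne; have vp : pvalid p by apply: contraNT ne => ?; rewrite coef_dfam_invalid.
split=> //; move: ne; rewrite coef_dfam; apply: contraNeq => ne.
rewrite big1 // => l _; rewrite (coef_kmul_homog (c := 1)) //; last exact: kmat_lin.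
case: ifP => // _; rewrite /kmat; case: ifP => _; last case: ifP => _.
- by rewrite coef_path /= xpair_eqE eq_sym (negPf ne) mul0r.
- by rewrite coef_scale coef_path /= xpair_eqE eq_sym (negPf ne) mulr0 mul0r.
- by rewrite coef_nil mul0r.
Qed.

Lemma kosz_ker n X :
  (forall t, t \in kidx n -> I (D n.+1 X t)) <->
  (forall t, t \in kidx n.+1 -> c0 n.+1 X t = 0) /\
  (forall s i, (i <= n)%N -> comp_rel n.+1 X s i).
Proof.
split=> [h|[h0 hr] [s i]].
  have h' s i : (i <= n)%N -> [/\ c0 n.+1 X (s, i.+1) = 0, lam s i (n.+1 - i) * c0 n.+1 X (s, i) = 0
          & comp_rel n.+1 X s i].
    move=> le; have /(ideal_at (@D_at _ _ _)) [_ hR hL hS] : I (D n.+1 X (s, i)).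
      by apply: h; rewrite mem_kidx.
    by split; rewrite -?DR -?DL /comp_rel -?DS.
  split=> [[s [_|i]]|s i le]; rewrite ?mem_kidx ?ltnS; last by case: (h' s i).
    (* Only (s, 0) is not reached by a right step; it is reached by a left step with coefficient
       1. *)
    by have [_ + _] := h' s 0%N isT; rewrite /= mul1r.
  by move=> le; case: (h' s i).
rewrite mem_kidx => le; apply/(ideal_at (@D_at _ _ _)); split.
- exact: D0.
- by have := DR X s le; rewrite /cR => ->; apply: h0; rewrite mem_kidx.
- by have := DL X s le; rewrite /cL => ->; rewrite h0 ?mulr0 // mem_kidx ltnW.
- by have := DS X s le; rewrite /cS => ->; apply: hr.
Qed.

(** The two ways around a square of the cover cancel in the socle, so consecutive differentials
    compose to zero modulo the ideal. *)
Lemma lam_rel s i j : kap (pos s i j) * lam s i.+1 j.+1 + kap (tau (pos s i j)) * lam s i j.+1 = 0.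
Proof.
rewrite lamS posSS.
by field; apply: kap_neq0.
Qed.

Lemma kosz_im n X : felt kidx kvt n X ->
  (exists Y, felt kidx kvt n.+1 Y /\ forall t, t \in kidx n -> I (ksub (D n.+1 Y t) (X t))) <->
  (forall t, t \in kidx n -> c0 n X t = 0) /\
  (forall s i, (i < n)%N -> comp_rel n X s i).
Proof.
move=> fX.
have subE Y t : t \in kidx n -> I (ksub (D n.+1 Y t) (X t)) <->
   [/\ c0 n (D n.+1 Y) t = c0 n X t, cR n (D n.+1 Y) t = cR n X t,
       cL n (D n.+1 Y) t = cL n X t & cS n (D n.+1 Y) t = cS n X t].
  move=> tn; rewrite (ideal_at (at_vertex_sub (@D_at _ _ _) (felt_at fX tn))).
  rewrite soc_sub !coef_sub.
  rewrite /c0 /cR /cL /cS; split=> -[e1 e2 e3 e4].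
    by split; [exact: subr0_eq e1|exact: subr0_eq e2|exact: subr0_eq e3|exact: subr0_eq e4].
  by split; apply/eqP; rewrite subr_eq0; apply/eqP.
split=> [[Y [fY h]]|[h0 hr]].
  split=> [t tn|s i lt].
    by have [<- _ _ _] := (subE Y t tn).1 (h t tn); rewrite D0.
  have mR : (s, i) \in kidx n by rewrite mem_kidx ltnW.
  have mL : (s, i.+1) \in kidx n by rewrite mem_kidx.
  have [_ eR _ _] := (subE Y _ mR).1 (h _ mR).
  have [_ _ eL _] := (subE Y _ mL).1 (h _ mL).
  rewrite /comp_rel -eR -eL DR ?(ltnW lt) // (DL Y s lt) subSS.
  have -> : (n - i = (n.-1 - i).+1)%N by lia.
  move: (lam_rel s i (n.-1 - i)); move: (lam s i.+1 _) (lam s i _) => a b e.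
  by rewrite mulrA -mulrDl e mul0r.
(* The vertex coordinates are chosen to produce the right arrow coordinates of [X], and at (s, 0)
   the left one. The other left coordinates then come out correctly by [comp_rel]. *)
pose y0 (t : qV Q * nat) := if t.2 is i.+1 then cR n X (t.1, i) else cL n X (t.1, 0%N).
(* The left arrow coordinate at (s, i + 1) alone produces the socle coordinate at (s, i); right
   arrow coordinates are zero. *)
pose yL (t : qV Q * nat) :=
  if t.2 is i.+1 then cS n X (t.1, i) / kap (pos t.1 i (n - i)) else 0.
pose Y (t : qV Q * nat) : kq K Q :=
  [:: (y0 t, (kvt n.+1 t, [::])); (yL t, (kvt n.+1 t, [:: tau (pos t.1 t.2 (n.+1 - t.2))]))].
have Y0 t : c0 n.+1 Y t = y0 t.
  by rewrite /c0 /Y !coef_cons coef_nil eqxx xpair_eqE andbF !addr0.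
have YR t : cR n.+1 Y t = 0.
  rewrite /cR /Y !coef_cons coef_nil !xpair_eqE !eqxx /= eqseq_cons.
  by rewrite (negPf (tau_neq _)) !addr0.
have YL t : cL n.+1 Y t = yL t.
  by rewrite /cL /Y !coef_cons coef_nil !xpair_eqE !eqxx /= addr0 add0r.
exists Y; split.
  move=> t p _; rewrite /Y !coef_cons coef_nil addr0.
  case: (altP (_ =P p)) => [<- _|_]; first by [].
  case: (altP (_ =P p)) => [<- _|_]; last by rewrite addr0 eqxx.
  by rewrite /pvalid /= qs_tau eqxx.
move=> [s i] tn; apply/subE => //; move: tn (tn); rewrite {1}mem_kidx => le tn.
split; first by rewrite D0 h0.
- by rewrite DR // Y0.
- rewrite (DL Y s le) Y0; case: i le tn => [|i] le tn; first by rewrite /= mul1r.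
  have /eqP := hr s i le; rewrite /comp_rel addr_eq0 => /eqP e.
  apply: (mulfI (kap_neq0 (pos s i (n.-1 - i)))); rewrite e -mulNr [y0 _]/=.
  rewrite subSS; have -> : (n - i = (n.-1 - i).+1)%N by lia.
  move: (lam_rel s i (n.-1 - i)); move: (lam s i.+1 _) (lam s i _) => a b /eqP.
  by rewrite mulrA addr_eq0 => /eqP ->.
- rewrite DS // YR mulr0 addr0 YL /yL /= mulrC divfK //; exact: kap_neq0.
Qed.

Lemma kosz_res : exists gen mat, @min_graded_res K A gen mat /\
    forall n g, g \in gen n -> g.2 = delta 2 n.
Proof.
exists (fgen kidx kvt (delta 2)), (fmat kidx kmat).
split; last by move=> n g /mapP [t _ ->].
apply: fam_res => //.
- exact: kidx_uniq.
- have : kidx 0 = [seq (s, 0%N) | s <- enum (qV Q)].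
    by rewrite /kidx; elim: (enum _) => //= s l ->.
  by move=> ->; rewrite -map_comp -[RHS]map_id; apply: eq_map => s; rewrite /kvt /= qs_r0.
- move=> n [s i] l p; rewrite mem_kidx => le ln ne; move: (kmat_lin ne) => sp.
  rewrite !delta2 sp addn1; move: ne; rewrite /kmat; case: ifP => [/eqP ->|_].
    rewrite coef_path; case: (altP (_ =P p)) => [<- _|]; rewrite ?eqxx //.
    by rewrite pvalid1 /kvt /= subSS qs_tau qt_sg.
  case: ifP => [/eqP ->|_]; last by rewrite coef_nil eqxx.
  rewrite coef_scale coef_path; case: (altP (_ =P p)) => [<- _|]; rewrite ?mulr0 ?eqxx //.
  by rewrite -{1}qs_tau pvalid1 /kvt [(_, _).1]/= [(_, _).2]/= subSn // posSr qt_sg.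
- move=> X fX; rewrite (kosz_im fX); split=> [h|[h _] t tn]; last exact: h.
  by split=> [t tn|s i]; [exact: h|].
- move=> n X fX; rewrite (kosz_im fX) kosz_ker; split=> -[h hr]; split=> // s i le;
    exact: hr.
Qed.

End Koszul.

(** * Betti numbers of linear resolutions *)

Section ExactCard.
Variables (K : fieldType) (I J L : finType) (P : {pred I}) (R : {pred J}) (S : {pred L}).
Variables (Psi : I -> J -> K) (Phi : J -> L -> K).
Local Open Scope ring_scope.

Definition vec_fun (T : finType) (B : {pred T}) (v : 'rV[K]_#|B|) (t : T) : K :=
  \sum_(k < #|B|) v 0 k * (enum_val k == t)%:R.

Lemma vec_funE (T : finType) (B : {pred T}) (v : 'rV[K]_#|B|) (k : 'I_#|B|) :
  vec_fun v (enum_val k) = v 0 k.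
Proof.
rewrite /vec_fun (bigD1 k) //= eqxx mulr1 big1 ?addr0 // => i ne.
by rewrite (inj_eq enum_val_inj) (negPf ne) mulr0.
Qed.

(** The dimension count of a short exact sequence with bases [P], [R], [S]: injectivity and
    surjectivity give the ranks of the two matrices, and exactness in the middle equates the rank of
    the first with the nullity of the second. *)
Lemma exact_card :
  (forall y, (forall j, j \in R -> \sum_(i in P) y i * Psi i j = 0) ->
     forall i, i \in P -> y i = 0) ->
  (forall i l, i \in P -> l \in S -> \sum_(j in R) Psi i j * Phi j l = 0) ->
  (forall z, (forall l, l \in S -> \sum_(j in R) z j * Phi j l = 0) ->
     exists y, forall j, j \in R -> z j = \sum_(i in P) y i * Psi i j) ->
  (forall w : L -> K, exists z, forall l, l \in S -> \sum_(j in R) z j * Phi j l = w l) ->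
  (#|P| + #|S| = #|R|)%N.
Proof.
move=> inj cpx ker sur.
pose A : 'M[K]_(#|P|, #|R|) := \matrix_(i, j) Psi (enum_val i) (enum_val j).
pose B : 'M[K]_(#|R|, #|S|) := \matrix_(i, j) Phi (enum_val i) (enum_val j).
have AB : A *m B = 0.
  apply/matrixP => i l; rewrite !mxE -[RHS](cpx (enum_val i) (enum_val l)) ?enum_valP //.
  by rewrite [RHS]big_enum_val; apply: eq_bigr => j _; rewrite !mxE.
have rA : \rank A = #|P|.
  apply/eqP; apply: inj_row_free => v vA; apply/rowP => k; rewrite mxE -vec_funE.
  apply: inj; last exact: enum_valP.
  move=> j jR; rewrite big_enum_val -(enum_rankK_in jR jR).
  have /rowP /(_ (enum_rank_in jR j)) := vA; rewrite !mxE => e; rewrite -[RHS]e.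
  by apply: eq_bigr => i _; rewrite vec_funE !mxE.
have rB : \rank B = #|S|.
  apply/eqP; rewrite -[_ == _]/(row_full B) -sub1mx; apply/row_subP => l0.
  have [z hz] := sur (fun l => (l == enum_val l0)%:R).
  apply/submxP; exists (\row_j z (enum_val j)); apply/rowP => l; rewrite !mxE.
  have := hz (enum_val l) (enum_valP _); rewrite big_enum_val.
  rewrite (inj_eq enum_val_inj) eq_sym => <-.
  by apply: eq_bigr => j _; rewrite !mxE.
have kAB : (kermx B <= A)%MS.
  apply/row_subP => r; set z := row r _.
  have zB : z *m B = 0 by rewrite /z -row_mul mulmx_ker row0.
  have [l lS|y hy] := ker (vec_fun z).
    rewrite big_enum_val -(enum_rankK_in lS lS).
    have /rowP /(_ (enum_rank_in lS l)) := zB; rewrite !mxE => e; rewrite -[RHS]e.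
    by apply: eq_bigr => j _; rewrite vec_funE !mxE.
  apply/submxP; exists (\row_i y (enum_val i)); apply/rowP => j.
  rewrite -vec_funE hy ?enum_valP // big_enum_val !mxE.
  by apply: eq_bigr => i _; rewrite !mxE.
have : \rank A = \rank (kermx B).
  apply/eqP; rewrite eqn_leq !mxrankS //; exact/sub_kermxP.
rewrite mxrank_ker rA rB => ->; rewrite subnK // -rB; exact: rank_leq_row.
Qed.
End ExactCard.

(** * A concavity argument for functions on the vertices of a finite quiver *)

Section Count.
Variables (V B : finType) (src tgt : B -> V) (u : nat -> V -> nat).
Hypothesis rec : forall n v, u n.+2 v + u n v = \sum_(b | tgt b == v) u n.+1 (src b).
Hypothesis out_le2 : forall v, #|[pred b | src b == v]| <= 2.
Variable v0 : V.
Hypothesis out_v0 : #|[pred b | src b == v0]| <= 1.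
Hypothesis conn : forall Z : V -> Prop,
  (forall b, Z (tgt b) -> Z (src b)) -> Z v0 -> forall v, Z v.

Definition total n := \sum_v u n v.

(** Sum the recursion over v and group the arrows by source: at most two leave each vertex and at
    most one leaves [v0]. *)
Lemma count_concave n : total n.+2 + total n + u n.+1 v0 <= 2 * total n.+1.
Proof.
have -> : total n.+2 + total n = \sum_b u n.+1 (src b).
  rewrite -big_split /=; under eq_bigr => v _ do rewrite rec.
  by rewrite (exchange_big_dep predT) //=; apply: eq_bigr => b _;
  rewrite (big_pred1 (tgt b)) // => v; rewrite /= eq_sym.
rewrite (partition_big src predT) //=.
rewrite (eq_bigr (fun v => #|[pred b | src b == v]| * u n.+1 v)); last first.
  move=> v _; rewrite -sum1_card big_distrl /=.
  by apply: eq_bigr => b /eqP ->; rewrite mul1n.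
rewrite (bigD1 v0) //= /total [X in _ <= 2 * X](bigD1 v0) //= mulnDr addnAC.
apply: leq_add; first by rewrite mul2n -addnn leq_add2r -[leqRHS]mul1n leq_mul2r out_v0 orbT.
by rewrite big_distrr /=; apply: leq_sum => v _; rewrite leq_mul2r out_le2 orbT.
Qed.

(** By concavity one decrease would be followed by a decrease at every later step, and the total
    would become negative. *)
Lemma count_mono n : total n <= total n.+1.
Proof.
rewrite leqNgt; apply/negP => lt.
have step k : total (n + k) + k <= total n /\ total (n + k).+1 < total (n + k).
  elim: k => [|k [IH1 IH2]]; first by rewrite !addn0.
  by have := count_concave (n + k); rewrite !addnS; lia.
have [] := step (total n).+1; lia.
Qed.

(* the increments of t decrease by at least u n v0, and are nonnegative *)
Lemma count_v0_vanish : exists N, forall n, N <= n -> u n v0 = 0.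
Proof.
(* Summed concavity. As totals do not decrease, all partial sums are at most [total 1], so only
   finitely many terms are nonzero. *)
have bound k : \sum_(i < k) u i.+1 v0 + total k.+1 <= total k + total 1.
  elim: k => [|k IH]; first by rewrite big_ord0 leq_addl.
  rewrite big_ord_recr /=; move: IH (count_concave k); move: (\sum_(i < k) _) => S; lia.
have bound' k : \sum_(i < k) u i.+1 v0 <= total 1.
  by have := bound k; have := count_mono k; lia.
apply: NNPP => h; have big m : exists k, m <= \sum_(i < k) u i.+1 v0.
  elim: m => [|m [k hk]]; first by exists 0.
  have [n kn un] : exists2 n, k < n & u n v0 != 0.
    apply: NNPP => h'; apply: h; exists k.+1 => n kn; apply/eqP.
    by apply: contraT => un; case: h'; exists n.
  exists n; rewrite -(subnKC kn) (addSnnS k) big_split_ord /=.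
  rewrite [X in _ + X]big_ord_recr /= (_ : (k + (n - k.+1)).+1 = n); last by lia.
  move: hk un; rewrite -lt0n; move: (\sum_(i < k) _) (\sum_(i < n - k.+1) _) => S1 S2.
  lia.
have [k hk] := big (total 1).+1; have := bound' k; lia.
Qed.

(** Eventual vanishing passes from the target of an arrow to its source, because the value at the
    source is a summand in the recursion at the target. *)
Lemma count_vanish : exists n, forall v, u n v = 0 /\ u n.+1 v = 0.
Proof.
have ev : forall v, exists N, forall n, N <= n -> u n v = 0.
  apply: conn count_v0_vanish => b [N h]; exists N.+1 => -[//|n] Nn.
  have h2 : u n.+2 (tgt b) = 0 by apply: h; apply: leqW; apply: leqW.
  move: (rec n (tgt b)); rewrite h2 (h n Nn) => /esym /eqP.
  by rewrite sum_nat_eq0 => /forall_inP /(_ b (eqxx _)) /eqP.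
have [N hN] := fin_all_exists ev.
exists (\max_v N v) => v; split; apply: (hN v); last apply: leqW; exact: leq_bigmax.
Qed.

(** Vanishing in two consecutive degrees propagates downwards by the recursion. *)
Lemma count_contra : u 0 v0 = 0.
Proof.
have [n] := count_vanish; elim: n => [|n IH] h; first by case: (h v0).
apply: IH => v; split; last by case: (h v).
have := rec n v; rewrite (h v).2 big1 // => b _; by case: (h (src b)).
Qed.
End Count.

(** * Generators of a linear resolution when all cycles have length two *)

Section Betti.
Variables (K : fieldType) (A : pres K).
Local Notation Q := (pQ A).
Local Notation I := (in_ideal (prel A)).
Variables (sg : qA Q -> qA Q) (kap : qA Q -> K) (out : qV Q -> qA Q).
Hypothesis qt_sg : forall a, qs (sg a) = qt a.
Hypothesis sgK : involutive sg.
Hypothesis qs_out : cancel out (@qs Q).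
Local Open Scope ring_scope.
Hypothesis kap_neq0 : forall a, kap a != 0.
Hypothesis idealE : forall x, I x <->
  [/\ forall p, ~~ pvalid p -> coef x p = 0,
      forall p, pvalid p -> (size p.2 < 2)%N -> coef x p = 0
    & forall v, socle_coef sg kap x v = 0].
Local Notation soc := (socle_coef sg kap).
Variables (gen : nat -> seq (qV Q * nat)) (mat : nat -> nat -> nat -> kq K Q).
Hypothesis res : min_graded_res gen mat.
Hypothesis gen_deg : forall n g, g \in gen n -> g.2 = n.
Variable v0 : qV Q.

Local Notation N n := (size (gen n)).
Definition vtx n l : qV Q := (nth (v0, 0%N) (gen n) l).1.

Lemma onth_gen n l : (l < N n)%N -> onth (gen n) l = Some (vtx n l, n).
Proof.
move=> ln; rewrite onthE (nth_map (v0, 0%N)) //; congr Some.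
by rewrite [LHS]surjective_pairing (gen_deg (mem_nth _ ln)).
Qed.

Lemma onth_lt (T : Type) (s : seq T) k x : onth s k = Some x -> (k < size s)%N.
Proof. by move=> e; rewrite -onthTE e. Qed.

(** Generators of consecutive projectives differ by one in degree, so all entries are combinations
    of arrows. *)
Lemma mat_supp n k l p : (k < N n)%N -> (l < N n.+1)%N -> coef (mat n.+1 k l) p != 0 ->
  [/\ pvalid p, psrc p = vtx n k, ptgt p = vtx n.+1 l & size p.2 = 1%N].
Proof.
move=> kn ln ne; have [_ h _ _] := res.
have [-> -> -> _ e] := h _ _ _ _ _ _ _ _ (onth_gen kn) (onth_gen ln) ne.
by split=> //; apply: (@addnI n); rewrite e addn1.
Qed.

Definition elt n (X : nat -> kq K Q) := forall l, (l < N n)%N -> at_vertex (vtx n l) (X l).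

Definition DD n (X : nat -> kq K Q) k : kq K Q :=
  flatten [seq kmul (mat n.+1 k l) (X l) | l <- iota 0 (N n.+1)].

Lemma elt_pelt n X : elt n X -> pelt gen n (mkseq X (N n)).
Proof.
move=> h; split; first by rewrite size_mkseq.
move=> l xl vl dl p e1 e2 ne; have ln := onth_lt e2.
move: e2; rewrite onth_gen // => -[<- _]; apply: h => //.
by move: e1; rewrite onthE (nth_map [::]) ?size_mkseq // nth_mkseq // => -[->].
Qed.

Lemma pelt_elt n x : pelt gen n x -> elt n (nth [::] x).
Proof.
move=> [sx h] l ln p ne; apply: (h l _ _ n p _ (onth_gen ln) ne).
by rewrite onthE (nth_map [::]) // sx.
Qed.

Lemma nth_dmap n x X k : (k < N n)%N -> (forall l, (l < N n.+1)%N -> nth [::] x l = X l) ->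
  nth [::] (dmap gen mat n.+1 x) k = DD n X k.
Proof.
move=> kn h; rewrite /dmap nth_mkseq //; congr flatten.
by apply/eq_in_map => l; rewrite mem_iota => /andP [_ ln]; rewrite h.
Qed.

(** Membership in the image of the differential from P_(n+1), modulo the ideal. *)
Definition hits n (X : nat -> kq K Q) := exists Y, elt n.+1 Y /\
  forall k, (k < N n)%N -> I (ksub (DD n Y k) (X k)).

Lemma hitsE n X : hits n X <->
  exists y, pelt gen n.+1 y /\ forall k, (k < N n)%N ->
    I (ksub (nth [::] (dmap gen mat n.+1 y) k) (nth [::] (mkseq X (N n)) k)).
Proof.
split=> [[Y [eY hY]]|[y [py hy]]].
  exists (mkseq Y (N n.+1)); split=> [|k kn]; first exact: elt_pelt.
  by rewrite (nth_dmap (X := Y)) ?nth_mkseq // => [|l ln]; [exact: hY|rewrite nth_mkseq].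
exists (nth [::] y); split=> [|k kn]; first exact: pelt_elt.
by have := hy k kn; rewrite (nth_dmap kn (fun _ _ => erefl)) nth_mkseq.
Qed.

Lemma res_exact n X : elt n.+1 X -> (forall k, (k < N n)%N -> I (DD n X k)) <-> hits n.+1 X.
Proof.
move=> eX; have [_ _ _ h] := res; rewrite hitsE -h; last exact: elt_pelt.
have e k : (k < N n)%N -> nth [::] (dmap gen mat n.+1 (mkseq X (N n.+1))) k = DD n X k.
  by move=> kn; apply: nth_dmap => // l ln; rewrite nth_mkseq.
by split=> h' k kn; [rewrite e // | rewrite -e //]; apply: h'.
Qed.

Lemma res_exact0 X : elt 0 X ->
  (forall k, (k < N 0)%N -> coef (X k) (vtx 0 k, [::]) = 0) -> hits 0 X.
Proof.
move=> eX h0; have [_ _ h _] := res; rewrite hitsE; apply/h; first exact: elt_pelt.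
move=> l xl v dv e1 e2; have ln := onth_lt e2.
move: e2; rewrite onth_gen // => -[<- _].
by move: e1; rewrite onthE (nth_map [::]) ?size_mkseq // nth_mkseq // => -[<-]; apply: h0.
Qed.

Section D.
Variables (n : nat) (X : nat -> kq K Q) (k : nat).
Hypothesis kn : (k < N n)%N.

Lemma mat_lin l p : (l < N n.+1)%N -> coef (mat n.+1 k l) p != 0 -> size p.2 = 1%N.
Proof. by move=> ln ne; case: (mat_supp kn ln ne). Qed.

Lemma coef_DD p : coef (DD n X k) p = \sum_(l < N n.+1) coef (kmul (mat n.+1 k l) (X l)) p.
Proof. by rewrite coef_flatten -{1}(subn0 (N n.+1)) -/(index_iota 0 _) big_mkord. Qed.

Lemma coef_DD0 v : coef (DD n X k) (v, [::]) = 0.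
Proof.
rewrite coef_DD big1 // => l _; apply: coef_linmul0 => p; exact: mat_lin.
Qed.

Lemma coef_DD1 a : coef (DD n X k) (qs a, [:: a]) =
  \sum_(l < N n.+1) coef (mat n.+1 k l) (qs a, [:: a]) * coef (X l) (qt a, [::]).
Proof.
rewrite coef_DD; apply: eq_bigr => l _; apply: coef_linmul1 => p; exact: mat_lin.
Qed.

Lemma soc_DD v : soc (DD n X k) v = \sum_(l < N n.+1) \sum_(a | qs a == v)
  kap a * coef (mat n.+1 k l) (v, [:: a]) * coef (X l) (qt a, [:: sg a]).
Proof.
rewrite soc_flatten -{1}(subn0 (N n.+1)) -/(index_iota 0 _) big_mkord.
apply: eq_bigr => l _; rewrite soc_linmul // => p; exact: mat_lin.
Qed.

Lemma DD_at : at_vertex (vtx n k) (DD n X k).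
Proof.
move=> p ne; have vp : pvalid p.
  apply: contraNT ne => /negPf vp; rewrite coef_DD big1 // => l _.
  by rewrite coef_kmul vp.
split=> //; move: ne; rewrite coef_DD; apply: contraNeq => ne; rewrite big1 // => l _.
rewrite (coef_kmul_homog (c := 1)) // => [|q]; last exact: mat_lin.
case: ifP => // _; have [->|/(mat_supp kn (ltn_ord l)) [_ e _ _]] := eqVneq (coef (mat n.+1 k l) (ptake 1 p)) 0.
  by rewrite mul0r.
by rewrite -e eqxx in ne.
Qed.

Lemma ideal_DD : (forall b, qs b = vtx n k -> coef (DD n X k) (qs b, [:: b]) = 0) ->
  soc (DD n X k) (vtx n k) = 0 -> I (DD n X k).
Proof.
have z p : (pvalid p -> psrc p = vtx n k -> coef (DD n X k) p = 0) -> coef (DD n X k) p = 0.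
  move=> h; apply/eqP; apply: contraT => ne; have [vp ep] := DD_at ne.
  by rewrite h ?eqxx in ne.
move=> h1 h2; apply/idealE; split=> [p /negPf vp|[v [|b [|c s]]] vp //= _|v].
- by apply: z; rewrite vp.
- exact: coef_DD0.
- apply: z => _; rewrite /psrc /= => ev.
  by move: vp; rewrite /pvalid /= andbT => /eqP eb; rewrite -{1}eb h1 ?eb.
- have [<- //|ne] := eqVneq (vtx n k) v.
  rewrite /socle_coef big1 // => b eb; rewrite z ?mulr0 // => _ e.
  by rewrite -e /psrc /= eqxx in ne.
Qed.
End D.

(** For n = 0 the element lies in the radical. Otherwise it is a cycle, because a linear entry times
    paths of length at least two lies in the ideal. *)
Lemma hits_socle n X : elt n X ->
  (forall l v s, (l < N n)%N -> (size s < 2)%N -> coef (X l) (v, s) = 0) -> hits n X.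
Proof.
case: n => [|n] eX h; first by apply: res_exact0 => // k kn; apply: h.
apply/(res_exact eX) => k kn; apply: ideal_DD => // [b eb|].
  by rewrite coef_DD1 // big1 // => l _; rewrite h ?mulr0.
by rewrite soc_DD // big1 // => l _; rewrite big1 // => a _; rewrite h ?mulr0.
Qed.

Section Step.
Variables (n : nat) (v : qV Q).
Local Notation IT := 'I_(N n.+2).
Local Notation JT := ('I_(N n.+1) * qA Q)%type.
Local Notation LT := 'I_(N n).
(* The part of the complex in degree n + 2 at the vertex v: the generators of P_(n+2),
   the arrows times the generators of P_(n+1), and the socles of P_n. *)
Let P : {pred IT} := fun i => vtx n.+2 i == v.
Let R : {pred JT} := fun p => (qs p.2 == vtx n.+1 p.1) && (qt p.2 == v).
Let S : {pred LT} := fun k => vtx n k == v.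
Let Psi (i : IT) (j : JT) : K := coef (mat n.+2 j.1 i) (vtx n.+1 j.1, [:: j.2]).
Let Phi (j : JT) (k : LT) : K := kap (sg j.2) * coef (mat n.+1 k j.1) (v, [:: sg j.2]).

(** The socle paths at [v] are [sg b] followed by [b] for the arrows [b] into [v]; hence the
    reindexing by [sg]. *)
Lemma soc_Phi X (k : LT) : elt n.+1 X ->
  soc (DD n X k) v = \sum_(j in R) coef (X j.1) (vtx n.+1 j.1, [:: j.2]) * Phi j k.
Proof.
move=> eX; rewrite soc_DD //.
rewrite [RHS](eq_bigl (fun j : JT => predT j.1 && ((qs j.2 == vtx n.+1 j.1) && (qt j.2 == v)))) //.
rewrite -(pair_big_dep predT (fun (l : 'I_(N n.+1)) b => (qs b == vtx n.+1 l) && (qt b == v))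
   (fun l b => coef (X l) (vtx n.+1 l, [:: b]) * Phi (l, b) k)) /=.
apply: eq_bigr => l _; rewrite (reindex_inj (inv_inj sgK)) /=.
rewrite [RHS]big_mkcond [LHS]big_mkcond; apply: eq_bigr => b _.
rewrite qt_sg; case: (qt b == v); rewrite ?andbF // andbT.
rewrite -[qt (sg b)]qt_sg sgK; case: eqP => [->|ne]; first by rewrite mulrC.
have [-> |/(eX l (ltn_ord l)) [_ /ne []]] := eqVneq (coef (X l) (qs b, [:: b])) 0.
by rewrite mulr0.
Qed.

Lemma step_card : (#|P| + #|S| = #|R|)%N.
Proof.
apply: (@exact_card K _ _ _ P R S Psi Phi).
(* Injectivity: a cycle of P_(n+2) with components only at vertices is in the image of the next
   differential, which has no component at vertices. *)
- move=> y hy i iP.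
  pose X (i : nat) : kq K Q :=
    if insub i is Some i' then if P i' then [:: (y i', (v, [::]))] else [::] else [::].
  have cX (i' : IT) p : coef (X i') p = if P i' && ((v, [::]) == p) then y i' else 0.
    rewrite /X valK; case: ifP => _; last by rewrite coef_nil.
    by rewrite coef_cons coef_nil addr0.
  have eX : elt n.+2 X.
    move=> l ln p; rewrite (cX (Ordinal ln)); case: ifP; rewrite ?eqxx //.
    by move=> /andP [/eqP <- /eqP <-].
  have /(res_exact eX) [Y [eY hY]] : forall k, (k < N n.+1)%N -> I (DD n.+1 X k).
    move=> k kn; apply: ideal_DD => // [b eb|].
      rewrite coef_DD1 //; have [ev|ne] := eqVneq (qt b) v; last first.
        rewrite big1 // => l _; rewrite cX xpair_eqE eq_sym (negPf ne) andbF mulr0 //.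
      rewrite -[RHS](hy (Ordinal kn, b)); last by rewrite unfold_in /= eb ev !eqxx.
      rewrite [RHS]big_mkcond; apply: eq_bigr => l _; rewrite cX ev eqxx andbT unfold_in.
      by rewrite /P /Psi /= -eb; case: (vtx _ l == v); rewrite ?mulr0 // mulrC.
    rewrite soc_DD // big1 // => l _; rewrite big1 // => a _.
    by rewrite cX xpair_eqE /= !andbF mulr0.
  have [_ /(_ (v, [::]) isT isT) + _] := (idealE _).1 (hY _ (ltn_ord i)).
  rewrite coef_sub coef_DD0 // cX eqxx andbT (iP : P i = true) sub0r => /eqP.
  by rewrite oppr_eq0 => /eqP.
(* The composition is zero: the differential is applied twice to the i-th generator and the socle
   coefficient is read off. *)
- move=> i l iP lS.
  pose Y (i' : nat) : kq K Q := if i' == i then kpath K (v, [::]) else [::].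
  have cY (i' : nat) p : coef (Y i') p = ((i' == i) && ((v, [::]) == p))%:R.
    by rewrite /Y; case: ifP; rewrite ?coef_path // coef_nil.
  have eY : elt n.+2 Y.
    move=> l' _ p; rewrite cY; case: (altP (l' =P i :> nat)) => [->|_]; rewrite ?eqxx //=.
    by case: (altP (_ =P p)) => [<- _|]; rewrite ?eqxx // (eqP iP).
  have eX : elt n.+1 (DD n.+1 Y) by move=> l' ln; apply: DD_at.
  have Il : I (DD n (DD n.+1 Y) l).
    apply: ((res_exact eX).2 _ _ (ltn_ord l)); exists Y; split=> // k kn.
    by apply: in_ideal_keq (in_ideal0 _) => p; rewrite coef_sub subrr coef_nil.
  have [_ _ /(_ v)] := (idealE _).1 Il; rewrite soc_Phi // => e; rewrite -[RHS]e.
  apply: eq_bigr => -[k b]; rewrite unfold_in /= => /andP [/eqP eb /eqP et].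
  rewrite -eb coef_DD1 // (bigD1 i) //= cY !eqxx et eqxx mulr1 big1 ?addr0.
    by rewrite /Psi /= eb.
  by move=> i' /negPf ne; rewrite cY (_ : (_ == _) = false) ?mulr0 // -ne.
(* Exactness in the middle: [z] gives a cycle of P_(n+1) supported on arrows into [v], and the
   vertex coefficients of a preimage are the required [y]. *)
- move=> z hz.
  pose X (l : nat) : kq K Q := if insub l is Some l' then
    [seq (z (l', b), (vtx n.+1 l', [:: b])) | b <- enum (qA Q) & R (l', b)] else [::].
  have cX (l : 'I_(N n.+1)) p : coef (X l) p =
      \sum_(b | R (l, b)) z (l, b) * ((vtx n.+1 l, [:: b]) == p)%:R.
    rewrite /X valK /coef big_map big_filter_cond big_enum_cond /=.
    by rewrite big_mkcondr; apply: eq_bigr => b _; case: eqP; rewrite ?mulr1 ?mulr0.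
  have cX1 (l : 'I_(N n.+1)) w b : coef (X l) (w, [:: b]) =
      if R (l, b) && (w == vtx n.+1 l) then z (l, b) else 0.
    rewrite cX big_mkcond (bigD1 b) //= big1 ?addr0 => [|c /negPf ne].
      rewrite xpair_eqE eqxx andbT [w == _]eq_sym.
      by case: (R _); case: (_ == _); rewrite ?mulr1 ?mulr0.
    by rewrite xpair_eqE eqseq_cons ne andbF mulr0 if_same.
  have eX : elt n.+1 X.
    move=> l ln p; rewrite (cX (Ordinal ln)) => ne.
    have /existsP [b /andP [Rb /eqP <-]] :
        [exists b, R (Ordinal ln, b) && ((vtx n.+1 l, [:: b]) == p)].
      apply: contraR ne => /existsPn h; rewrite big1 // => b Rb.
      by move: (h b); rewrite Rb /= => /negPf ->; rewrite mulr0.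
    by move: Rb; rewrite /R /= => /andP [/eqP <- _]; rewrite pvalid1.
  have /(res_exact eX) [Y [eY hY]] : forall k, (k < N n)%N -> I (DD n X k).
    move=> k kn; apply: ideal_DD => // [b eb|].
      rewrite coef_DD1 // big1 // => l _.
      by rewrite cX big1 ?mulr0 // => c _; rewrite xpair_eqE andbF mulr0.
    have [ev|ne] := eqVneq (vtx n k) v; last first.
      rewrite soc_DD // big1 // => l _; rewrite big1 // => a /eqP ea.
      by rewrite cX1 /R /= -[qt (sg a)]qt_sg sgK ea (negPf ne) andbF mulr0.
    rewrite ev (soc_Phi (Ordinal kn) eX) -[RHS](hz (Ordinal kn)); last by rewrite unfold_in /= ev.
    by apply: eq_bigr => -[l b] lb; rewrite cX1 (lb : R (l, b) = true) eqxx.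
  exists (fun i : IT => coef (Y i) (v, [::])) => -[l b] lb.
  have Rlb : R (l, b) = true := lb; have /andP [/eqP /= eb /eqP /= et] := Rlb.
  have [_ /(_ _ (pvalid1 b) isT) + _] := (idealE _).1 (hY _ (ltn_ord l)).
  rewrite coef_sub cX1 Rlb eb eqxx => /subr0_eq <-; rewrite -eb coef_DD1 // et.
  rewrite [RHS]big_mkcond; apply: eq_bigr => i _; rewrite unfold_in /= /Psi /= -eb mulrC.
  rewrite /P; case: (altP (vtx n.+2 i =P v)) => [//|/eqP ne].
  have [->|/(eY i (ltn_ord i)) [_ /esym /ne []]] := eqVneq (coef (Y i) (v, [::])) 0.
  by rewrite mul0r.
(* Surjectivity: one socle path at [v], through [out v], carries the prescribed values; the arrow
   coefficients of a preimage give [z]. *)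
- move=> w; pose a := out v.
  pose X (k : nat) : kq K Q := if insub k is Some k' then
     if S k' then [:: (w k' / kap a, (v, [:: a; sg a]))] else [::] else [::].
  have cX (k : LT) p : coef (X k) p = if S k && ((v, [:: a; sg a]) == p) then w k / kap a else 0.
    rewrite /X valK; case: ifP => _; last by rewrite coef_nil.
    by rewrite coef_cons coef_nil addr0.
  have eX : elt n X.
    move=> l ln p; rewrite (cX (Ordinal ln)); case: ifP; rewrite ?eqxx //.
    by move=> /andP [/eqP /= -> /eqP <-]; rewrite -{1}(qs_out v) pvalid_soc.
  have socX (k : LT) : S k -> soc (X k) v = w k.
    move=> Sk; rewrite /socle_coef (bigD1 a) /= ?qs_out // cX Sk eqxx /= big1 ?addr0.
      by rewrite mulrC divfK.
    move=> b /andP [_ /negPf ne]; rewrite cX xpair_eqE eqseq_cons.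
    by rewrite [a == b]eq_sym ne !andbF mulr0.
  have [Y [eY hY]] : hits n X.
    apply: hits_socle => // l v' s ln; rewrite (cX (Ordinal ln)) xpair_eqE.
    by case: (altP (_ =P s)) => [<- //|]; rewrite !andbF.
  exists (fun j : JT => coef (Y j.1) (vtx n.+1 j.1, [:: j.2])) => k kS.
  rewrite -soc_Phi // -socX //; have [_ _ /(_ v)] := (idealE _).1 (hY _ (ltn_ord k)).
  by rewrite soc_sub => /subr0_eq.
Qed.
End Step.

Definition betti n v := #|[pred l : 'I_(N n) | vtx n l == v]|.

Lemma betti_rec n v :
  (betti n.+2 v + betti n v = \sum_(b : qA Q | qt b == v) betti n.+1 (qs b))%N.
Proof.
rewrite [LHS](step_card n v) -sum1_card.
rewrite (eq_bigl (fun j : 'I_(N n.+1) * qA Q =>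
   predT j.1 && ((qs j.2 == vtx n.+1 j.1) && (qt j.2 == v)))) //.
rewrite -(pair_big_dep predT (fun (l : 'I_(N n.+1)) b => (qs b == vtx n.+1 l) && (qt b == v))
   (fun _ _ => 1%N)) /=.
rewrite (exchange_big_dep (fun b => qt b == v)) /=; last by move=> l b _ /andP [].
apply: eq_bigr => b /eqP ->; rewrite /betti -sum1_card; apply: eq_bigl => l.
by rewrite eqxx andbT inE eq_sym.
Qed.

Lemma betti0 v : (0 < betti 0 v)%N.
Proof.
have [g0 _ _ _] := res; apply/card_gt0P.
have vm : v \in enum (qV Q) by rewrite mem_enum.
have vl : (index v (enum (qV Q)) < N 0)%N by rewrite g0 size_map index_mem.
exists (Ordinal vl); rewrite inE /vtx /= g0 (nth_map v) ?index_mem //=.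
by rewrite nth_index.
Qed.
End Betti.

(** * Brauer graphs and their relations *)

Section Homog.
Variables (K : fieldType) (Q : quiver) (R : seq (kq K Q)).

Lemma in_ideal_infix x p : in_ideal R x ->
  (forall r l s t, r \in R -> p.2 = l ++ s ++ t -> coef r (ptgt (p.1, l), s) = 0%R) ->
  coef x p = 0%R.
Proof.
move=> Ix h; apply: in_ideal_coef0 Ix => a r b rR; apply/eqP; apply: contraT => ne.
have [s [vp ep eb]] := sandwichP ne; move: vp ne h; rewrite ep => vp + h.
by rewrite coef_sandwich // (surjective_pairing a) (h _ _ _ b.2) // eqxx.
Qed.

Lemma homog_mem d r : (forall i, i < size R -> homog d (nth [::] R i)) ->
  r \in R -> homog d r.
Proof. by move=> h rR; rewrite -(nth_index [::] rR); apply: h; rewrite index_mem. Qed.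
End Homog.

(** * The ideal generated by the paths of length d when arrows are determined by their source *)

Section SerialIdeal.
Variables (K : fieldType) (A : pres K).
Local Notation Q := (pQ A).
Variables (out : qV Q -> qA Q) (d : nat).
Hypothesis out_qs : cancel (@qs Q) out.
Hypothesis relP : forall r, r \in prel A -> exists v, r = kpath K (v, spath out v d).
Hypothesis memR : forall v, kpath K (v, spath out v d) \in prel A.
Local Open Scope ring_scope.

(** For the converse the normal form keeps short paths and is zero otherwise: a valid path of length
    at least [d] begins with the relation at its source. *)
Lemma serial_idealE x : in_ideal (prel A) x <->
  (forall p, pvalid p -> (size p.2 < d)%N -> coef x p = 0) /\
  (forall p, ~~ pvalid p -> coef x p = 0).
Proof.
split=> [Ix|[h1 h2]].
  split=> p vp; last exact: in_ideal_invalid Ix vp.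
  move=> sp; apply: (in_ideal_infix Ix) => r l s t /relP [v ->] e.
  rewrite coef_path; case: eqP => // -[_ es]; move: sp; rewrite e -es !size_cat size_spath.
  by rewrite ltnNge addnCA leq_addr.
apply: (@in_ideal_normal _ _ _ (fun p => if (size p.2 < d)%N then kpath K p else [::])) => //.
- move=> p vp; case: ltnP => [_|le].
    by apply: in_ideal_keq (in_ideal0 _) => a; rewrite coef_sub subrr coef_nil.
  have e := pvalid_spathE out_qs vp.
  have e2 : p.2 = spath out p.1 d ++ drop d p.2.
    by rewrite -{1}(cat_take_drop d p.2) {1}(congr1 snd e) /= take_spath.
  have := @in_ideal_path K Q _ (p.1, [::]) (ptgt (p.1, spath out p.1 d), drop d p.2) _ (memR p.1).
  rewrite /= -e2 -surjective_pairing => /(_ vp erefl erefl).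
  by apply: in_ideal_keq => a; rewrite coef_sub coef_nil subr0.
- move=> p; rewrite big1 // => a _; case: ifP => [sa|_]; last by rewrite coef_nil mulr0.
  by have [va|va] := boolP (pvalid a); [rewrite h1 | rewrite h2]; rewrite ?mul0r.
Qed.
End SerialIdeal.

(** * Half-edges, arrows and walks around a vertex *)

Section Graph.
Variable G : bgraph.
Hypothesis HG : is_bgraph G.
Local Notation sigma := (bsucc G).
Implicit Types (h x y : bH G) (s : bE G) (a b : bA G).

Lemma hv_succ h : hv (sigma h) = hv h.
Proof. by case: HG => _ [_ [-> _]]. Qed.

Lemma card_porbit_valency h : #|porbit sigma h| = valency (hv h).
Proof.
rewrite /valency; apply: eq_card => x; rewrite !inE; apply/porbitP/eqP => [[i ->]|/esym e].
  by rewrite permX; elim: i => //= i IH; rewrite hv_succ.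
have [_ [_ [_ [+ _]]]] := HG; move=> /(_ _ _ e) [k <-].
by exists k; rewrite permX.
Qed.

Lemma iter_valency h : iter (valency (hv h)) sigma h = h.
Proof. by rewrite -card_porbit_valency iter_porbit. Qed.

Lemma valency_gt0 h : 0 < valency (hv h).
Proof. by rewrite -card_porbit_valency; apply/card_gt0P; exists h; apply: porbit_id. Qed.

Lemma mult_gt0 (v : bV G) : 0 < bmult v.
Proof. by case: HG => _ [_ [_ [_ [_ [_ ->]]]]]. Qed.

Lemma ntrunc_succ h : ntrunc (sigma h) = ntrunc h.
Proof. by rewrite /ntrunc hv_succ. Qed.

Lemma halvesP s : exists h1 h2, [/\ halves s = [:: h1; h2], h1 != h2, he h1 = s, he h2 = s &
  forall h, he h = s -> h = h1 \/ h = h2].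
Proof.
have [_ [c2 _]] := HG.
have mem h : (h \in halves s) = (he h == s) by rewrite mem_filter mem_enum andbT.
have un : uniq (halves s) by rewrite filter_uniq // enum_uniq.
have : size (halves s) = 2.
  by rewrite -(c2 s) -(card_uniqP un); apply: eq_card => h; rewrite mem inE.
case: (halves s) mem un => [|h1 [|h2 []]] //= mem; rewrite !inE andbT => ne _.
exists h1, h2; split=> //; first by apply/eqP; rewrite -mem mem_head.
  by apply/eqP; rewrite -mem !inE eqxx orbT.
by move=> h /eqP; rewrite -mem !inE => /orP [] /eqP; [left|right].
Qed.

(** Connectedness as an induction principle. *)
Lemma graph_ind (Z : bH G -> Prop) :
  (forall x y, he x = he y -> Z x -> Z y) ->
  (forall x y, hv x = hv y -> Z x -> Z y) ->
  forall x, Z x -> forall y, Z y.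
Proof.
move=> h1 h2 x Zx y; have [_ [_ [_ [_ [_ [c _]]]]]] := HG.
have /connectP [p pp ->] := c x y.
elim: p x Zx pp => //= z p IH x Zx /andP [/orP [/eqP e|/eqP e] pp]; apply: (IH z) => //.
  exact: h1 e Zx.
exact: h2 e Zx.
Qed.

Lemma trunc_unique x y : ~~ ntrunc x -> hv x = hv y -> x = y.
Proof.
move=> /negPn /andP [/eqP v1 _] e; apply/eqP; move/eqP/cards1P: v1 => [z /setP e'].
by have := e' x; have := e' y; rewrite !inE e !eqxx => /esym /eqP -> /esym /eqP ->.
Qed.

(** The successor restricts to arrows because truncation depends only on the vertex. *)
Definition sA (a : bA G) : bA G := Sub (sigma (val a)) (etrans (ntrunc_succ _) (valP a)).

Lemma val_sA a : val (sA a) = sigma (val a).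
Proof. exact: SubK. Qed.

Lemma val_iter_sA n a : val (iter n sA a) = iter n sigma (val a).
Proof. by elim: n => //= n ->. Qed.

Lemma pmap_toA_traject a n : pmap (@toA G) (traject sigma (val a) n) = traject sA a n.
Proof. by elim: n a => //= n IH a; rewrite /toA valK /= -val_sA IH. Qed.

(** The length L of the path C^m at the vertex of [a]. *)
Definition clen (a : bA G) := bmult (hv (val a)) * valency (hv (val a)).

Lemma flatten_succseq h m : flatten (nseq m (succseq h)) = traject sigma h (m * valency (hv h)).
Proof.
elim: m => //= m ->; rewrite mulSn trajectD iter_valency //.
Qed.

Lemma cycpow_traject a m :
  cycpow (val a) m = traject sA a (m * valency (hv (val a))).
Proof. by rewrite /cycpow flatten_succseq pmap_toA_traject. Qed.

Lemma iter_clen a : iter (clen a) sA a = a.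
Proof.
apply: val_inj; rewrite val_iter_sA /clen iterM.
by elim: (bmult _) => //= m ->; rewrite iter_valency.
Qed.

(** For n = L this is C^m, and for n = L + 1 the path of a relation of type two. *)
Definition around (a : bA G) n : qpath (bquiver G) := (he (val a), traject sA a n).

Lemma Cpow_around a : Cpow (val a) = around a (clen a).
Proof. by rewrite /Cpow cycpow_traject. Qed.

Lemma t2path_around a : t2path (val a) = around a (clen a).+1.
Proof.
rewrite /t2path /around flatten_succseq pmap_cat pmap_toA_traject -/(clen a).
by rewrite -[[:: val a]]/(traject sigma (val a) 1) pmap_toA_traject [traject _ _ (clen a).+1]trajectSr iter_clen cats1.
Qed.

Lemma clen_ge2 a : 2 <= clen a.
Proof.
have := valP a; rewrite /= /ntrunc /truncv negb_and /clen.
have := valency_gt0 (val a); have := mult_gt0 (hv (val a)).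
case: (bmult _) (valency _) => [|[|m]] [|[|v]] //; lia.
Qed.

Lemma pvalid_around a n : pvalid (around a n).
Proof. by rewrite /pvalid /=; elim: n a => //= n IH a; rewrite eqxx /= -val_sA IH. Qed.
End Graph.

Lemma sandwich_right (K : fieldType) (Q : quiver) (r : kq K Q) v w t :
  all (fun u => [&& pvalid u.2, psrc u.2 == v & ptgt u.2 == w]) r -> vpath w t ->
  sandwich (v, [::]) r (w, t) = [seq (u.1, (u.2.1, u.2.2 ++ t)) | u <- r].
Proof.
move=> ar vt; rewrite /sandwich.
have -> : kmul (kpath K (v, [::])) r = r.
  rewrite /kmul /= cats0 -[RHS]map_id (_ : [seq u <- r | _] = r).
    by apply/eq_in_map => -[c [u1 u2]] /(allP ar) /and3P [/= _ /eqP <- _]; rewrite mul1r.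
  apply/all_filterP/allP => u /(allP ar) /and3P [-> /eqP <- _].
  by rewrite /ptgt /pvalid /= eqxx.
elim: r ar => //= u r IH /andP [/and3P [vu _ /eqP tu] /IH e].
rewrite /kmul /= in e *; rewrite e.
by rewrite vu tu /psrc /= eqxx /pvalid /= vt /= mulr1.
Qed.

(** * The three types of relations in terms of arrows *)

Section Rels.
Variables (G : bgraph) (K : fieldType) (q : bE G -> bV G -> K).
Hypothesis HG : is_bgraph G.
Local Notation sigma := (bsucc G).
Local Notation Q := (bquiver G).
Local Notation sA := (sA HG).
Local Notation around := (around HG).
Implicit Types (h x y : bH G) (s : bE G) (a b : bA G).
Local Open Scope ring_scope.

Definition qa (a : bA G) := q (he (val a)) (hv (val a)).

Lemma halves_he s h : h \in halves s -> he h = s.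
Proof. by rewrite mem_filter => /andP [/eqP]. Qed.

Lemma mem_halves h : h \in halves (he h).
Proof. by rewrite mem_filter eqxx mem_enum. Qed.

Lemma etruncP s h : he h = s -> ~~ etrunc s -> ntrunc h.
Proof. by move=> <- /hasPn /(_ _ (mem_halves h)). Qed.

Lemma traject_infix c n a b : infix [:: a; b] (traject sA c n) -> b = sA a.
Proof.
move=> /infixP [l [r e]].
have : sorted (frel sA) (traject sA c n) by case: n {e} => //= n; apply: fpath_traject.
by rewrite e => /cat_sorted2 [_ /=] /andP [/eqP].
Qed.

(** A pair [a], [b] of type three has [b != sA a], since [a] and its successor begin the path C^m,
    which has at least two arrows. *)
Lemma brelsP r : r \in brels q ->
  [\/ exists a1 a2, [/\ a1 != a2, he (val a1) = he (val a2), ~~ etrunc (he (val a1))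
        & r = [:: (qa a1, around a1 (clen a1)); (- qa a2, around a2 (clen a2))]],
      exists a, etrunc (he (val a)) /\ r = kpath K (around a (clen a).+1)
    | exists a b, [/\ qt (q := Q) a = qs (q := Q) b, b != sA a
        & r = kpath K ((he (val a), [:: a; b]) : qpath Q)]].
Proof.
rewrite mem_cat => /orP [|].
  move=> /flattenP [_ /mapP [s _ ->]]; rewrite mem_cat /type1 /type2.
  have [h1 [h2 [eh ne e1 e2 e3]]] := halvesP HG s; rewrite eh => /orP [|].
    case: ifP => // /andP [n1 n2]; rewrite inE => /eqP ->.
    constructor 1; exists (Sub h1 n1), (Sub h2 n2); split.
    - by rewrite -val_eqE.
    - by rewrite !SubK e1 e2.
    - by rewrite SubK e1 /etrunc eh /= orbF negb_or; apply/andP.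
    - by rewrite /qa -!Cpow_around !SubK.
  case: ifP => [/andP [n1 n2]|_]; last case: ifP => // /andP [n1 n2].
    rewrite inE => /eqP ->; constructor 2; exists (Sub h2 n2).
    rewrite -t2path_around !SubK; split=> //.
    by rewrite e2 /etrunc eh /=; move: n1; rewrite /ntrunc negbK => ->.
  rewrite inE => /eqP ->; constructor 2; exists (Sub h1 n1).
  rewrite -t2path_around !SubK; split=> //.
  by rewrite e1 /etrunc eh /=; move: n2; rewrite /ntrunc negbK => ->; rewrite orbT.
move=> /flattenP [_ /mapP [a _ ->]] /mapP [b]; rewrite mem_filter => /andP [/andP [/eqP e nh] _] ->.
constructor 3; exists a, b; split=> //; apply: contraNneq nh => ->.
apply/hasP; exists (val a); first by rewrite mem_filter mem_enum andbT (valP a).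
have := cycpow_traject HG a (bmult (hv (val a))) => ->; rewrite -/(clen a).
have := clen_ge2 HG a; case: (clen a) => [|[|n]] // _.
by apply/infixP; exists [::], (traject sA (sA (sA a)) n).
Qed.

Lemma type2_mem a : etrunc (he (val a)) -> kpath K (around a (clen a).+1) \in brels q.
Proof.
have [h1 [h2 [eh ne e1 e2 e3]]] := halvesP HG (he (val a)) => et.
rewrite mem_cat; apply/orP; left; apply/flattenP.
exists (type1 q (he (val a)) ++ type2 K (he (val a))); first by apply: (map_f (fun s => type1 q s ++ type2 K s)); rewrite mem_enum.
rewrite mem_cat; apply/orP; right; rewrite /type2 eh -t2path_around.
move: et; rewrite /etrunc eh /= orbF; have na := valP a.
case: (e3 (val a) erefl) => ea; rewrite -ea {1}/ntrunc; move: na; rewrite /= /ntrunc.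
  by move=> na /orP [t1|t2]; [rewrite t1 in na | rewrite na t2 /= inE].
by move=> na /orP [t1|t2]; [rewrite t1 na /= inE | rewrite t2 in na].
Qed.

Lemma type3_mem a b : qt (q := Q) a = qs (q := Q) b -> b != sA a ->
  kpath K ((he (val a), [:: a; b]) : qpath Q) \in brels q.
Proof.
move=> /= e ne; rewrite mem_cat; apply/orP; right; apply/flattenP; eexists.
  by apply: map_f; rewrite mem_enum.
apply/mapP; exists b => //; rewrite mem_filter mem_enum e eqxx andbT /=.
apply: contra ne => /hasP [h]; rewrite mem_filter => /andP [nh _].
have := cycpow_traject HG (Sub h nh); rewrite SubK => -> /traject_infix ->.
exact: eqxx.
Qed.

Lemma ptgt_around a n : ptgt (around a n) = he (val (iter n sA a)).
Proof.
elim: n a => // n IH a; rewrite iterSr -IH /ptgt /around /=.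
by rewrite -val_sA.
Qed.

Lemma ptgt_cycle a : ptgt (around a (clen a)) = he (val a).
Proof. by rewrite ptgt_around iter_clen. Qed.

(** A relation of type one multiplied by [t] on the right. The order of the half-edges in [halves]
    fixes the sign of the relation; for [a = a'] the difference is zero. *)
Lemma type1_ideal a a' t : he (val a) = he (val a') -> vpath (Q := Q) (he (val a)) t ->
  in_ideal (brels q)
    (ksub (kscale (qa a) (kpath K ((he (val a), traject sA a (clen a) ++ t) : qpath Q)))
          (kscale (qa a') (kpath K ((he (val a), traject sA a' (clen a') ++ t) : qpath Q)))).
Proof.
move=> e vt; have [<-|ne] := eqVneq a a'.
  by apply: in_ideal_keq (in_ideal0 _) => p; rewrite coef_sub subrr coef_nil.
have [h1 [h2 [eh n12 e1 e2 e3]]] := halvesP HG (he (val a)).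
have main b b' : he (val b) = he (val a) -> halves (he (val a)) = [:: val b; val b'] ->
   in_ideal (brels q) [:: (qa b, (he (val a), traject sA b (clen b) ++ t) : qpath Q);
                          (- qa b', (he (val a), traject sA b' (clen b') ++ t) : qpath Q)].
  move=> eb ehb; have eb' : he (val b') = he (val a).
    by apply: halves_he; rewrite ehb !inE eqxx orbT.
  have := @in_ideal_sandwich K Q (brels q) (he (val a), [::])
     [:: (qa b, around b (clen b)); (- qa b', around b' (clen b'))] (he (val a), t).
  rewrite sandwich_right //=; last first.
    by rewrite !pvalid_around !ptgt_cycle /psrc /= eb eb' eqxx.
  rewrite eb eb'; apply.
  rewrite mem_cat; apply/orP; left; apply/flattenP.
  exists (type1 q (he (val a)) ++ type2 K (he (val a))).
    by apply: (map_f (fun s => type1 q s ++ type2 K s)); rewrite mem_enum.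
  rewrite mem_cat; apply/orP; left; rewrite /type1 ehb (valP b) (valP b') /=.
  by rewrite !Cpow_around inE.
have [n1 n2] : val a \in halves (he (val a)) /\ val a' \in halves (he (val a)).
  by rewrite {2}e !mem_halves.
have nv : val a != val a' by rewrite val_eqE.
move: n1 n2; rewrite eh !inE => /orP [/eqP ea|/eqP ea] /orP [/eqP ea'|/eqP ea'].
- by rewrite ea ea' eqxx in nv.
- apply: in_ideal_keq (main a a' erefl _) => [p|]; last by rewrite eh ea ea'.
  rewrite coef_sub !coef_scale !coef_path !coef_cons coef_nil.
  by case: ((_, _ ++ t) == p); case: ((_, _ ++ t) == p) => /=; ring.
- apply: in_ideal_keq (in_ideal_scale (-1) (main a' a (esym e) _)) => [p|]; last by rewrite eh ea ea'.
  rewrite coef_sub !coef_scale !coef_path !coef_cons coef_nil.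
  by case: ((_, _ ++ t) == p); case: ((_, _ ++ t) == p) => /=; ring.
- by rewrite ea ea' eqxx in nv.
Qed.

Lemma coef_short r w t : r \in brels q -> coef r (w, t) != 0 -> (2 <= size t)%N /\
  (size t = 2%N -> (exists2 a, clen a = 2%N & t = [:: a; sA a]) \/
                (exists a b, b != sA a /\ t = [:: a; b])).
Proof.
move=> /brelsP [[a1 [a2 [ne e12 nt ->]]]|[a [et ->]]|[a [b [e ne ->]]]].
- have C a : around a (clen a) = (w, t) -> (2 <= size t)%N /\
    (size t = 2%N -> (exists2 a, clen a = 2%N & t = [:: a; sA a]) \/
                (exists a b, b != sA a /\ t = [:: a; b])).
    move=> [_ <-]; rewrite size_traject; split=> [|ea]; first exact: clen_ge2.
    by left; exists a; rewrite // ea.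
  rewrite !coef_cons coef_nil; case: (altP (around a1 _ =P _)) => [/C //|_].
  by case: (altP (around a2 _ =P _)) => [/C //|_]; rewrite !addr0 eqxx.
- rewrite coef_path; case: (altP (_ =P (w, t))) => [[_ <-] _|_]; last by rewrite eqxx.
  rewrite /= size_traject; have := clen_ge2 HG a; split; lia.
- rewrite coef_path; case: (altP (_ =P (w, t))) => [[_ <-] _|_]; last by rewrite eqxx.
  by split=> // _; right; exists a, b.
Qed.

(** Relations have length at least two, so only one involving this very path could contribute. In
    length two they involve only cycles with L = 2 and pairs that are not consecutive around a
    vertex. *)
Lemma coef_corner (x : kq K Q) a v : in_ideal (brels q) x -> (2 < clen a)%N -> coef x (v, [:: a; sA a]) = 0.
Proof.
move=> Ix La; apply: (in_ideal_infix Ix) => r l s t rR e; apply/eqP; apply: contraT => ne.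
have [s2 hs] := coef_short rR ne.
have [sz [l0 t0]] : size s = 2%N /\ l = [::] /\ t = [::].
  have := congr1 size e; rewrite !size_cat /= => e'.
  case: l t e' {e ne} => [|? ?] [|? ?] /= e'; first (by split=> //; lia); exfalso; move: s2 e'; rewrite /= ?add0n; move: (size s) => k; lia.
move: e; rewrite l0 t0 cats0 /= => e; case: (hs sz) => [[b Lb es]|[b [c [nb es]]]].
  by move: e; rewrite es => -[eb _]; rewrite eb Lb in La.
by move: e nb; rewrite es => -[-> ->]; rewrite eqxx.
Qed.
End Rels.

(** * Brauer graph algebras with all cycles of length two *)

Lemma big_supp (K : nmodType) (T : eqType) (l l' : seq T) (f : T -> K) :
  uniq l -> uniq l' -> (forall t, f t != 0%R -> t \in l) -> (forall t, f t != 0%R -> t \in l') ->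
  (\sum_(t <- l) f t = \sum_(t <- l') f t)%R.
Proof.
move=> ul ul' h h'; rewrite (bigID (fun t => f t == 0%R)) [RHS](bigID (fun t => f t == 0%R)) /=.
rewrite !(big1 _ (fun t => f t == 0%R)); try by move=> t /eqP.
rewrite !add0r -big_filter -[RHS]big_filter; apply: perm_big; apply: uniq_perm.
- exact: filter_uniq.
- exact: filter_uniq.
- by move=> t; rewrite !mem_filter; case: eqP => //= /eqP ne; rewrite h // h'.
Qed.

Section QuadIdeal.
Local Arguments kscale : simpl never.
Variables (G : bgraph) (K : fieldType) (q : bE G -> bV G -> K).
Hypothesis HG : is_bgraph G.
Hypothesis Hq : quantizing q.
Local Notation Q := (bquiver G).
Local Notation sA := (sA HG).
Local Notation around := (around HG).
Implicit Types (s : bE G) (a b : bA G).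
Local Open Scope ring_scope.

(* The value at C_a of the symmetrizing form, which therefore vanishes on the relations
   of type one; q is unconstrained at truncated edges. *)
Definition kap (a : bA G) : K := if etrunc (he (val a)) then 1 else (qa q a)^-1.

Lemma qa_neq0 a : ~~ etrunc (he (val a)) -> qa q a != 0.
Proof. exact: Hq. Qed.

Lemma kap_neq0 a : kap a != 0.
Proof.
by rewrite /kap; case: ifPn => [_|/qa_neq0]; rewrite ?oner_neq0 // invr_eq0.
Qed.

Variable out : bE G -> bA G.
Hypothesis qs_out : forall s, he (val (out s)) = s.
Hypothesis L2 : forall a, clen a = 2%N.

Lemma sAK : involutive sA.
Proof. by move=> a; have := iter_clen HG a; rewrite L2. Qed.

Lemma sigma2 a : bsucc G (bsucc G (val a)) = val a.
Proof. by rewrite -!(val_sA HG) sAK. Qed.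

Lemma ptgt_corner a : ptgt ((he (val a), [:: a; sA a]) : qpath Q) = he (val a).
Proof. by have := ptgt_cycle HG a; rewrite L2. Qed.

Lemma sA_qt a : qs (q := Q) (sA a) = qt (q := Q) a.
Proof. by []. Qed.

Lemma aroundE a : around a 2 = (he (val a), [:: a; sA a]).
Proof. by []. Qed.

Lemma trunc_arrow_unique a b : etrunc (he (val a)) -> he (val a) = he (val b) -> a = b.
Proof.
have [h1 [h2 [eh ne e1 e2 e3]]] := halvesP HG (he (val a)) => et e.
move: et (valP a) (valP b); rewrite /etrunc eh /= orbF /ntrunc.
have := e3 _ (esym e); have := e3 _ erefl.
by move=> [] ea [] eb; rewrite ?ea ?eb => /orP [] t; rewrite ?t //;
   move=> _ _; apply: val_inj; rewrite ea eb.
Qed.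

(** As relations have length at least two, [a] and [b] are trivial whenever a socle path occurs, and
    only [r] itself must be tested. On type one the two values cancel by the choice of [kap]; types
    two and three involve no socle path. *)
Lemma soc_sandwich (a : qpath Q) r (b : qpath Q) v : r \in brels q -> socle_coef (Q := Q) sA kap (sandwich a r b) v = 0.
Proof.
move=> rR.
have [/existsP [c /andP [/eqP cv nc]]|] :=
    boolP [exists c, (qs (q := Q) c == v) && (coef (sandwich a r b) ((v, [:: c; sA c]) : qpath Q) != 0)];
  last first.
  rewrite negb_exists => /forallP h; rewrite /socle_coef big1 // => c /eqP cv.
  by move: (h c); rewrite cv eqxx /= negbK => /eqP ->; rewrite mulr0.
have [t [vp ep eb]] := sandwichP nc.
have [a0 b0] : a.2 = [::] /\ b.2 = [::].
  move: nc; rewrite ep coef_sandwich -?ep // => nr; have [s2 _] := coef_short HG rR nr.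
  case: ep => _ /(congr1 size); rewrite !size_cat /=; move: s2; move: (size t) => k.
  by case: a.2 b.2 => [|? ?] [|? ?] //=; lia.
have [eav ebv] : a = (v, [::]) /\ b = (v, [::]).
  case: ep => av ew; move: eb; rewrite a0 b0 /= cats0 in ew *.
  rewrite -ew -av => eb; split; first by rewrite av -a0 -surjective_pairing.
  rewrite [b]surjective_pairing b0 eb; congr (_, _); rewrite -cv.
  exact: ptgt_corner.
have -> : socle_coef (Q := Q) sA kap (sandwich a r b) v = socle_coef (Q := Q) sA kap r v.
  apply: eq_bigr => d /eqP dv; congr (_ * _); rewrite eav ebv.
  have := @coef_sandwich K Q (v, [::]) (v, [::]) r [:: d; sA d]; apply.
    by rewrite -dv; exact: (@pvalid_soc Q sA sA_qt d).
  by rewrite -dv; apply/esym/ptgt_corner.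
move/(brelsP HG): (rR) => [[a1 [a2 [ne e12 nt ->]]]|[a1 [et ->]]|[a1 [b1 [e ne ->]]]].
- rewrite /socle_coef; under eq_bigr => d _ do rewrite !coef_cons coef_nil addr0 !L2 !aroundE !xpair_eqE.
  have [ev|nv] := eqVneq (he (val a1)) v; last first.
    by rewrite big1 // => d _; rewrite -e12 (negPf nv) addr0 mulr0.
  rewrite -e12 ev eqxx /= (bigD1 a1) /= ?ev // (bigD1 a2) /= -?e12 ?ev ?eqxx ?[a2 == a1]eq_sym //.
  rewrite big1 ?addr0.
    rewrite !eqseq_cons !eqxx (negPf ne) [a2 == a1]eq_sym (negPf ne) /= addr0 add0r.
    rewrite /kap -e12 (negPf nt) mulVf ?qa_neq0 // mulrN mulVf ?subrr // qa_neq0 // -e12 //.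
  move=> d /andP [/andP [_ n1] n2]; rewrite !eqseq_cons.
  by rewrite [a1 == d]eq_sym [a2 == d]eq_sym (negPf n1) (negPf n2) addr0 mulr0.
- by rewrite /socle_coef big1 // => d _; rewrite coef_path L2 xpair_eqE /= !eqseq_cons !andbF mulr0.
- rewrite /socle_coef big1 // => d _; rewrite coef_path xpair_eqE !eqseq_cons.
  case: (altP (a1 =P d)) => [<-|]; last by rewrite !andbF mulr0.
  by rewrite (negPf ne) !andbF mulr0.
Qed.

(** All socle paths at a vertex are expressed by the one through [out]; the ratio of the [kap] keeps
    the socle coefficient unchanged. *)
Definition nform (p : qpath Q) : kq K Q :=
  match p.2 with
  | [::] | [:: _] => kpath K p
  | [:: a; b] => if (b == sA a) && (he (val a) == p.1)
                 then kscale (kap a / kap (out p.1)) (kpath K (around (out p.1) 2)) else [::]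
  | _ => [::]
  end.

Lemma ideal_type3 l a b t v : b != sA a -> pvalid ((v, l ++ [:: a; b] ++ t) : qpath Q) ->
  in_ideal (brels q) (kpath K ((v, l ++ [:: a; b] ++ t) : qpath Q)).
Proof.
move=> ne vp; move: (vp); rewrite /pvalid [p in vpath _ p]/= vpath_cat => /andP [_] /= /and3P [/eqP ea /eqP eb _].
have := @in_ideal_path K Q _ (v, l) (qt (q := Q) b, t) _ (type3_mem q (esym eb) ne).
apply=> //=.
by rewrite ptgt_cat /ptgt.
Qed.

(* a path of length three contains a relation of type three, is a relation of
   type two, or becomes a multiple of a relation of type three by type one *)
Lemma ideal_long (p : qpath Q) : pvalid p -> (2 < size p.2)%N -> in_ideal (brels q) (kpath K p).
Proof.
case: p => v [|a [|b [|c t]]] // vp _.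
have [eb|nb] := eqVneq b (sA a); last exact: (@ideal_type3 [::]).
have [ec|nc] := eqVneq c (sA b); last exact: (@ideal_type3 [:: a]).
have {}ec : c = a by rewrite ec eb sAK.
subst b c.
have ev : v = he (val a) by move: vp => /andP [/eqP].
subst v; have [et|nt] := boolP (etrunc (he (val a))).
  have := @in_ideal_path K Q _ (he (val a), [::]) (qt (q := Q) a, t) _ (type2_mem q HG et).
  by rewrite L2 /= sAK => h; apply: h.
have [a' [ne ea]] : exists a', a' != a /\ he (val a') = he (val a).
  have [h1 [h2 [eh ne e1 e2 e3]]] := halvesP HG (he (val a)).
  have n1 := etruncP e1 nt; have n2 := etruncP e2 nt.
  case: (e3 _ erefl) => e; [exists (Sub h2 n2)|exists (Sub h1 n1)].
    by rewrite -val_eqE !SubK e2 e eq_sym.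
  by rewrite -val_eqE !SubK e1 e.
have vt : vpath (Q := Q) (he (val a)) [:: a & t].
  by move: vp => /= /and4P [_ _ ? ?]; apply/andP.
have := type1_ideal q HG (esym ea) vt.
set x := ksub _ _ => Ix.
have I' : in_ideal (brels q) (kpath K ((he (val a), [:: a'] ++ [:: sA a'; a] ++ t) : qpath Q)).
  apply: ideal_type3; first by rewrite sAK eq_sym.
  by rewrite /pvalid /= ea !eqxx sigma2 ea eqxx; case/andP: vt.
have := in_ideal_scale (qa q a)^-1 (in_ideal_add Ix (in_ideal_scale (qa q a') I')).
apply: in_ideal_keq => p; rewrite coef_scale coef_cat coef_sub !coef_scale !L2.
by rewrite subrK mulKf // qa_neq0.
Qed.

Lemma nform_congr (p : qpath Q) : pvalid p -> in_ideal (brels q) (ksub (kpath K p) (nform p)).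
Proof.
have triv (z : kq K Q) : in_ideal (brels q) (ksub z z).
  by apply: in_ideal_keq (in_ideal0 _) => r; rewrite coef_sub subrr coef_nil.
have sub0 z : in_ideal (brels q) z -> in_ideal (brels q) (ksub z [::]).
  by apply: in_ideal_keq => r; rewrite coef_sub coef_nil subr0.
case: p => v [|a [|b [|c t]]] vp; rewrite /nform /=; try exact: triv; last first.
  exact/sub0/ideal_long.
move: (vp) => /and3P [/eqP /= ev /eqP eb _]; subst v.
have [->|nb] := eqVneq b (sA a); last first.
  by apply: sub0; apply: (@ideal_type3 [::] a b [::]).
rewrite eqxx /=; set c := out _; have ec : he (val c) = he (val a) by rewrite /c qs_out.
have [et|nt] := boolP (etrunc (he (val a))).
  rewrite -(trunc_arrow_unique et (esym ec)).
  apply: in_ideal_keq (in_ideal0 _) => r.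
  by rewrite coef_sub coef_scale divff ?kap_neq0 // mul1r subrr coef_nil.
have := in_ideal_scale (qa q a)^-1 (type1_ideal q HG (esym ec) (isT : vpath (Q := Q) _ [::])).
apply: in_ideal_keq => r; rewrite !coef_scale !coef_sub !coef_scale !L2 !cats0.
rewrite /kap ec (negPf nt) invrK mulrBr mulKf ?qa_neq0 // mulrA /around ec //.
Qed.

(** The conditions are linear forms that kill all sandwiches. Conversely, the normal forms of the
    terms of length two from a vertex add up to a multiple of its socle coefficient. *)
Lemma quad_idealE (x : kq K Q) : in_ideal (brels q) x <->
  [/\ forall p, ~~ pvalid p -> coef x p = 0,
      forall p, pvalid p -> (size p.2 < 2)%N -> coef x p = 0
    & forall v, socle_coef (Q := Q) sA kap x v = 0].
Proof.
split=> [Ix|[h0 h1 h2]].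
  split=> [p|p _ sp|v]; first exact: in_ideal_invalid Ix.
    apply: (in_ideal_infix Ix) => r l s t rR e; apply/eqP; apply: contraTT sp => ne.
    have [s2 _] := coef_short HG rR ne; rewrite e !size_cat -leqNgt.
    by apply: leq_trans s2 _; rewrite addnCA leq_addr.
  pose wt a : K := if qs (q := Q) a == v then kap a else 0.
  have wtE (y : kq K Q) : socle_coef (Q := Q) sA kap y v = \sum_a wt a * coef y ((v, [:: a; sA a]) : qpath Q).
    rewrite /socle_coef big_mkcond; apply: eq_bigr => a _; rewrite /wt.
    by case: ifP; rewrite ?mul0r.
  by rewrite wtE; apply: in_ideal_form Ix => a r b rR; rewrite -wtE soc_sandwich.
apply: (in_ideal_normal nform_congr h0) => p.
have short (a : qpath Q) : (size a.2 < 2)%N -> coef x a = 0.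
  by move=> sa; have [/h1 -> //|/h0 //] := boolP (pvalid a).
pose v := p.1; pose P (a : qA Q) : qpath Q := (v, [:: a; sA a]).
rewrite (big_supp (l' := [seq P a | a <- enum (qA Q) & qs (q := Q) a == v])).
- rewrite big_map big_filter big_enum_cond /=.
  transitivity (coef (kpath K (around (out v) 2)) p / kap (out v) * socle_coef (Q := Q) sA kap x v);
    last by rewrite h2 mulr0.
  rewrite /socle_coef mulr_sumr; apply: eq_bigr => a ea.
  by rewrite /nform /= eqxx ea coef_scale; ring.
- exact: undup_uniq.
- rewrite map_inj_uniq => [|a b [] //]; apply: filter_uniq; exact: enum_uniq.
- by move=> a; rewrite mulf_eq0 negb_or mem_undup => /andP [/coef_neq0_mem].
- move=> [w [|a [|b [|c t]]]]; try by rewrite short // mul0r eqxx.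
    2: by rewrite /nform /= coef_nil mulr0 eqxx.
  rewrite /nform /=; case: ifP => [/andP [/eqP -> /eqP <-]|_]; last first.
    by rewrite coef_nil mulr0 eqxx.
  rewrite coef_scale coef_path; case: (altP (around _ _ =P p)) => [ep _|_]; last first.
    by rewrite !mulr0 eqxx.
  have ev : v = he (val a) by rewrite /v -ep /= qs_out.
  apply/mapP; exists a; last by rewrite /P ev.
  by rewrite mem_filter mem_enum /= ev eqxx.
Qed.
End QuadIdeal.

(** * Homogeneous Brauer graph algebras *)

Section HomogGen.
Variables (K : fieldType) (Q : quiver) (R H : seq (kq K Q)) (d : nat).
Hypothesis RH : forall x, in_ideal R x <-> in_ideal H x.
Hypothesis homH : forall i, i < size H -> homog d (nth [::] H i).
Local Open Scope ring_scope.

(** A test for homogeneity without reference to the generators: if the ideal involves [p], then it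
    involves a subpath of [p] of length [d], because each generator is itself in the ideal. *)
Lemma homog_gen x p : in_ideal R x ->
  (forall z l s t, in_ideal R z -> p.2 = l ++ s ++ t -> size s = d ->
     coef z (ptgt (p.1, l), s) = 0) -> coef x p = 0.
Proof.
move=> /RH Ix h; apply: (in_ideal_infix Ix) => r l s t rH e.
apply/eqP; apply: contraT => ne; have [vs ss] := homog_mem homH rH ne.
pose v := ptgt (p.1, l).
have Iz : in_ideal R (sandwich (v, [::]) r (ptgt (v, s), [::])).
  by apply/RH; apply: in_ideal_sandwich.
have := h _ _ _ _ Iz e ss.
have := @coef_sandwich K Q (v, [::]) (ptgt (v, s), [::]) r s.
by rewrite /= cats0 => -> // e0; rewrite -/v e0 eqxx in ne.
Qed.

Lemma in_ideal_kpath p : pvalid p -> kpath K p \in R -> in_ideal R (kpath K p).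
Proof.
move=> vp pR; have := @in_ideal_path K Q R (p.1, [::]) (ptgt p, [::]) p pR.
by rewrite /= cats0 -surjective_pairing; apply.
Qed.
End HomogGen.

(** * Consequences of homogeneity for the Brauer graph *)

Section Main.
Variables (G : bgraph) (K : fieldType) (q : bE G -> bV G -> K).
Hypothesis HG : is_bgraph G.
Hypothesis Hq : quantizing q.
Local Notation Q := (bquiver G).
Local Notation sA := (sA HG).
Local Notation around := (around HG).
Local Notation B := (@Pres K Q (brels q)).
Implicit Types (s : bE G) (a b : bA G).

(** An edge truncated at both ends is the whole connected graph, which is then A_2 with
    multiplicities 1. *)
Lemma edge_arrow : ~~ A2_11 G -> forall s, exists a, he (val a) = s.
Proof.
move=> nA2 s; have [h1 [h2 [eh ne e1 e2 e3]]] := halvesP HG s.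
have [n1|t1] := boolP (ntrunc h1); first by exists (Sub h1 n1); rewrite SubK.
have [n2|t2] := boolP (ntrunc h2); first by exists (Sub h2 n2); rewrite SubK.
have all12 : forall x, x = h1 \/ x = h2.
  apply: (@graph_ind G HG (fun x => x = h1 \/ x = h2) _ _ h1); last by left.
    by move=> x y e [ex|ex]; apply: e3; rewrite -e ex.
  by move=> x y e [ex|ex]; [left|right]; subst x; rewrite -(trunc_unique _ e).
have allE t : t = s.
  by have [x [? [_ _ <- _ _]]] := halvesP HG t; case: (all12 x) => ->.
case/negP: nA2; apply/andP; split.
  apply/andP; split; first by rewrite (@eq_card1 _ s) // => t; rewrite !inE (allE t) eqxx.
  apply/existsP; exists s; rewrite eh; apply: contraNneq ne => e.
  by rewrite (trunc_unique t1 e).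
apply/forallP => v; have [_ [_ [_ [_ [hv _]]]]] := HG; have [x <-] := hv v.
by case: (all12 x) => ->; [move: t1|move: t2]; rewrite negbK => /andP [].
Qed.

Lemma clen_sA a : clen (sA a) = clen a.
Proof. by rewrite /clen val_sA hv_succ. Qed.

Lemma clen_traject a n b : b \in traject sA a n -> clen b = clen a.
Proof. by move=> /trajectP [i _ ->]; elim: i => //= i IH; rewrite clen_sA. Qed.

Lemma type2_in a : etrunc (he (val a)) ->
  in_ideal (brels q) (kpath K (around a (clen a).+1)).
Proof. by move=> et; apply: in_ideal_kpath (type2_mem q HG et); apply: pvalid_around. Qed.

(** If L > 2 at [a], the ideal involves no subpath of length two of a walk around [a], so a
    quadratic ideal involves no such walk. But the relation of type one or two at [a] does. *)
Lemma quadratic_clen : quadratic B -> forall a, clen a = 2.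
Proof.
move=> [_ [H [RH [homH _]]]] a; apply/eqP; rewrite eqn_leq clen_ge2 // andbT leqNgt.
apply/negP => La; have z y n : in_ideal (brels q) y -> coef y (around a n) = 0%R.
  move=> Iy; apply: (homog_gen RH homH Iy) => x l [|b [|c []]] t Ix //= e _.
  have inf : infix [:: b; c] (traject sA a n) by apply/infixP; exists l, t.
  rewrite (traject_infix inf); apply: (coef_corner HG _ Ix).
  by rewrite (@clen_traject a n) // e mem_cat mem_head orbT.
have [et|nt] := boolP (etrunc (he (val a))).
  by have := z _ (clen a).+1 (type2_in et); rewrite coef_path eqxx => /eqP; rewrite oner_eq0.
have [h1 [h2 [eh ne e1 e2 e3]]] := halvesP HG (he (val a)).
have n1 := etruncP e1 nt; have n2 := etruncP e2 nt.
have [a' [na ea]] : exists a', a' != a /\ he (val a') = he (val a).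
  case: (e3 _ erefl) => e; [exists (Sub h2 n2)|exists (Sub h1 n1)].
    by rewrite -val_eqE !SubK e2 e eq_sym.
  by rewrite -val_eqE !SubK e1 e.
have := z _ (clen a) (type1_ideal (t := [::]) q HG (esym ea) isT).
rewrite coef_sub !coef_scale !coef_path !cats0 eqxx mulr1.
rewrite [X in (_ * X)%R](_ : _ = 0%R) ?mulr0 ?subr0 => [/eqP|].
  by rewrite (negPf (qa_neq0 Hq nt)).
case: eqP => // -[]; have := clen_ge2 HG a; have := clen_ge2 HG a'.
by case: (clen a) (clen a') => [//|n] [//|n'] _ _ /= [ea']; rewrite ea' eqxx in na.
Qed.

Section Quad.
Variable out : bE G -> bA G.
Hypothesis qs_out : forall s, he (val (out s)) = s.
Hypothesis L2 : forall a, clen a = 2.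

Lemma quad_res : (forall s, ~~ etrunc s) -> exists gen mat, @min_graded_res K B gen mat /\
    forall n g, g \in gen n -> g.2 = delta 2 n.
Proof.
(* The arrow of the other half-edge; it exists because no edge is truncated, so the default is never
   taken. *)
move=> nt; pose tau a := odflt a [pick b | (he (val b) == he (val a)) && (b != a)].
have tauP a : he (val (tau a)) = he (val a) /\ tau a != a.
  rewrite /tau; case: pickP => [b /andP [/eqP -> ->] //|no].
  have [h1 [h2 [eh ne e1 e2 e3]]] := halvesP HG (he (val a)).
  have n1 := etruncP e1 (nt _); have n2 := etruncP e2 (nt _).
  case: (e3 _ erefl) => e.
    by have := no (Sub h2 n2); rewrite -val_eqE !SubK e2 e eqxx eq_sym ne.
  by have := no (Sub h1 n1); rewrite -val_eqE !SubK e1 e eqxx ne.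
have tot a b : he (val a) = he (val b) -> b = a \/ b = tau a.
  move=> e; have [ta na] := tauP a.
  have [h1 [h2 [eh ne e1 e2 e3]]] := halvesP HG (he (val a)).
  have := e3 _ erefl; have := e3 _ (esym e); have := e3 _ ta.
  by move=> [] et [] eb [] ea; (left; apply: val_inj; rewrite ea eb; done) ||
    (right; apply: val_inj; rewrite et eb; done) || (case/negP: na; apply/eqP/val_inj; rewrite ea et).
have tauK : involutive tau.
  move=> a; have [ta na] := tauP a; have [tta nta] := tauP (tau a).
  case: (tot a (tau (tau a))) => //; first by rewrite tta ta.
  by move=> e; rewrite e eqxx in nta.
apply: (@kosz_res K B sA tau (kap q) out) => //.
- exact: sAK.
- by move=> a; case: (tauP a).
- by move=> a; case: (tauP a).
- exact: kap_neq0.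
- exact: quad_idealE.
Qed.

Lemma arrows_at s : #|[pred b : bA G | he (val b) == s]| <= 2.
Proof.
have [h1 [h2 [eh ne e1 e2 e3]]] := halvesP HG s.
rewrite -(card_imset _ val_inj); apply: leq_trans (card_size [:: h1; h2]).
apply: subset_leq_card; apply/subsetP => x /imsetP [b]; rewrite inE => /eqP eb ->.
by rewrite !inE; case: (e3 _ eb) => ->; rewrite eqxx ?orbT.
Qed.

Lemma trunc_no_linear_res s gen mat : etrunc s -> @min_graded_res K B gen mat ->
  (forall n g, g \in gen n -> g.2 = n) -> False.
Proof.
move=> et res dg.
have := @betti0 K B gen mat res s s; rewrite lt0n => /eqP; apply.
apply: (@count_contra (bE G) (bA G) (@qs Q) (@qt Q) (@betti K B gen s)).
- move=> n v; apply: (@betti_rec K B sA (kap q) out _ _ _ _ _ gen mat) => //.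
  + exact: sAK.
  + exact: kap_neq0.
  + exact: quad_idealE.
- exact: arrows_at.
- rewrite (@eq_card1 _ (out s)) // => b; rewrite !inE.
  apply/eqP/eqP => [eb|->]; last exact: qs_out.
  by apply: (trunc_arrow_unique HG); rewrite ?qs_out ?(eb : he (val b) = s).
- move=> Z hZ Zs v; rewrite -(qs_out v).
  apply: (@graph_ind G HG (fun h => Z (he h)) _ _ (val (out s))); last by rewrite qs_out.
    by move=> x y ->.
  move=> x y e; have [nx|tx] := boolP (ntrunc x); last by rewrite (trunc_unique tx e).
  have [_ [_ [_ [+ _]]]] := HG; move=> /(_ _ _ e) [k <-].
  have -> : x = val (Sub x nx : bA G) by rewrite SubK.
  rewrite -(val_iter_sA HG); move: (Sub x nx) => a Za; elim: k => //= k IH.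
  (* As L = 2, the arrow [sA b] is opposite to [b], so closure against the arrows is also closure
     along them. *)
  move: (iter k sA a) IH => b Zb; apply: (hZ (sA b)).
  by rewrite /= (sigma2 HG L2).
Qed.
End Quad.

(** * The case where every edge is truncated *)

Section Star.
Hypothesis allt : forall s, etrunc s.
Variable out : bE G -> bA G.
Hypothesis qs_out : forall s, he (val (out s)) = s.

Lemma star_out_qs a : out (he (val a)) = a.
Proof. by apply: (trunc_arrow_unique HG) => //; rewrite qs_out. Qed.

(** L is constant around a vertex, and each edge carries only one arrow; the rest is
    connectedness. *)
Lemma star_clen a b : clen a = clen b.
Proof.
suff : forall x, (fun x => forall b, he (val b) = he x -> clen a = clen b) x by apply; reflexivity.
apply: (@graph_ind G HG (fun x => forall b, he (val b) = he x -> clen a = clen b) _ _ (val a))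
  => [x y -> //|x y e h c ec|c ec].
  have [nx|tx] := boolP (ntrunc x); last by apply: h; rewrite (trunc_unique tx e).
  have ny : ntrunc y by rewrite /ntrunc -e.
  have -> : c = Sub y ny by apply: (trunc_arrow_unique HG) => //; rewrite SubK.
  by rewrite (h (Sub x nx)) ?SubK // /clen !SubK e.
by rewrite (trunc_arrow_unique HG (allt _) ec).
Qed.

Lemma spath_traject v n : spath (A := B) out v n = traject sA (out v) n.
Proof.
elim: n v => //= n IH v; rewrite IH; congr (_ :: traject _ _ _).
by rewrite /nx /= -(val_sA HG) star_out_qs.
Qed.

Lemma star_res d : d_homogeneous B d -> exists gen mat, @min_graded_res K B gen mat /\
    forall n g, g \in gen n -> g.2 = delta d n.
Proof.
move=> [d2 [H [RH [homH _]]]].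
have [/card_gt0P [s0 _] _] := HG; pose L := clen (out s0).
(* Type one needs an untruncated edge, and type three two different arrows starting at one edge, so
   only type two remains. *)
have relP r : r \in brels q -> exists v, r = kpath K ((v, spath (A := B) out v L.+1) : qpath Q).
  move=> /(brelsP HG) [[a1 [a2 [_ _ nt _]]]|[a [_ ->]]|[a [b [e ne _]]]].
  - by rewrite allt in nt.
  - by exists (he (val a)); rewrite spath_traject star_out_qs /L (star_clen (out s0) a).
  - by case/eqP: ne; apply/esym/(trunc_arrow_unique HG) => //; rewrite val_sA.
have memR v : kpath K ((v, spath (A := B) out v L.+1) : qpath Q) \in brels q.
  have := type2_mem q HG (allt (he (val (out v)))).
  by rewrite /around qs_out -spath_traject (star_clen (out v) (out s0)).
have idealE := @serial_idealE K B out L.+1 star_out_qs relP memR.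
have It := type2_in (allt (he (val (out s0)))).
(* The ideal involves a path of length L + 1 but no shorter one, so it can be homogeneous only in
   degree L + 1. *)
have dL : d = L.+1.
  apply/eqP; apply: contraT => ne.
  have := homog_gen (p := around (out s0) L.+1) RH homH It.
  rewrite coef_path eqxx => e; suff /eqP : (1 : K)%R = 0%R by rewrite oner_eq0.
  apply: e => z l s t Iz e ss.
  have sL : size s < L.+1.
    have := congr1 size e; rewrite /= size_traject !size_cat ss; lia.
  have [h1 h2] := (idealE z).1 Iz.
  by have [/h1 -> //|/h2 ->] := boolP (pvalid ((ptgt ((around (out s0) L.+1).1, l), s) : qpath Q)).
rewrite dL; apply: (@serial_res K B out L.+1 qs_out star_out_qs) => //.
  (* Next vertices determine their arrows, and the successor is a permutation, so [nx] is
     injective. *)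
  move=> u v e; have : sA (out u) = sA (out v).
    by apply: (trunc_arrow_unique HG (allt _)); rewrite !val_sA.
  move/(congr1 val); rewrite !val_sA => /perm_inj /val_inj e'.
  by rewrite -(qs_out u) e' qs_out.
exact: ltnW (clen_ge2 HG (out s0)).
Qed.
End Star.

(** Entering an untruncated edge around one end and leaving around the other is a relation of type
    three, and a path of length two has no subpath of length [d]. *)
Lemma homog3_trunc d : 3 <= d -> d_homogeneous B d -> forall s, etrunc s.
Proof.
move=> d3 [_ [H [RH [homH _]]]] s; apply/negPn/negP => nt.
have [h1 [h2 [eh ne e1 e2 e3]]] := halvesP HG s.
pose b1 : bA G := Sub h1 (etruncP e1 nt); pose b2 : bA G := Sub h2 (etruncP e2 nt).
(* The predecessor of [b1], as L successor steps are the identity. *)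
pose a := iter (clen b1).-1 sA b1.
have sa : sA a = b1.
  by rewrite -[sA a]/(iter (clen b1).-1.+1 sA b1) prednK ?iter_clen // ltnW ?clen_ge2.
have e : qt (q := Q) a = qs (q := Q) b2.
  by rewrite /= -(val_sA HG) sa !SubK e1 e2.
have nb : b2 != sA a by rewrite sa -val_eqE !SubK eq_sym.
have vp : pvalid ((he (val a), [:: a; b2]) : qpath Q).
  by apply/and3P; split=> //; apply/eqP/esym.
have Ip := in_ideal_kpath vp (type3_mem q e nb).
have := homog_gen (p := ((he (val a), [:: a; b2]) : qpath Q)) RH homH Ip.
rewrite coef_path eqxx => h; suff /eqP : (1 : K)%R = 0%R by rewrite oner_eq0.
apply: h => z l t r _ /(congr1 size); rewrite !size_cat /=; lia.
Qed.
End Main.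

(** * The algebra K[x]/(x^2) *)

Lemma xsq_res (K : fieldType) : exists gen mat, @min_graded_res K (xsq K) gen mat /\
  forall n g, g \in gen n -> g.2 = delta 2 n.
Proof.
have E (u v : unit) : u = v by case: u; case: v.
pose out (_ : qV loopquiver) : qA loopquiver := tt.
have qs_out : cancel out (@qs loopquiver) by move=> v; apply: E.
have out_qs : cancel (@qs loopquiver) out by move=> a; apply: E.
apply: (@serial_res K (xsq K) out 2 qs_out out_qs) => //.
apply: (@serial_idealE K (xsq K) out 2 out_qs) => [r|v].
  by rewrite inE => /eqP ->; exists tt.
by case: v; rewrite inE.
Qed.

Lemma xsq_homog (K : fieldType) d : d_homogeneous (xsq K) d -> d <= 2.
Proof.
move=> [_ [H [RH [homH _]]]]; rewrite leqNgt; apply/negP => d3.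
pose p : qpath loopquiver := (tt, [:: tt; tt]).
have Ip : in_ideal (prel (xsq K)) (kpath K p) by apply: in_ideal_kpath => //; rewrite inE.
have := homog_gen (p := p) RH homH Ip.
rewrite coef_path eqxx => h; suff /eqP : (1 : K)%R = 0%R by rewrite oner_eq0.
by apply: h => z l t r _ /(congr1 size); rewrite !size_cat /=; lia.
Qed.

Section NotA2.
Variables (G : bgraph) (K : fieldType) (q : bE G -> bV G -> K).
Hypothesis HG : is_bgraph G.
Hypothesis Hq : quantizing q.
Local Notation B := (@Pres K (bquiver G) (brels q)).

(* K[x]/(x^3) is not quadratic *)
Lemma quadratic_A2_untruncated : ~~ A2_11 G -> isA2 G -> quadratic B -> forall s : bE G, ~~ etrunc s.
Proof.
move=> nA2 /andP [/eqP c1 _] HQ s; apply/negP => et.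
have [out qs_out] := fin_all_exists (edge_arrow HG nA2).
have L2 := quadratic_clen HG Hq HQ.
have one (s' : bE G) : s' = s.
  by have /card_le1_eqP := eq_leq c1; apply.
have uniqa (a : bA G) : a = out s.
  by apply: (trunc_arrow_unique HG); [rewrite (one (he _))|rewrite qs_out; apply: one].
have Ia := type2_in q HG (a := out s) (etrans (congr1 _ (qs_out s)) et).
have [_ [H [RH [homH _]]]] := HQ.
(* With a single arrow x and L = 2 the ideal contains x^3. Being quadratic it would have to involve
   x^2, whose coefficient is the socle coefficient up to a nonzero factor. *)
have := homog_gen (p := around HG (out s) (clen (out s)).+1) RH homH Ia.
rewrite coef_path eqxx => h; suff /eqP : (1 : K)%R = 0%R by rewrite oner_eq0.
apply: h => z l [|b [|c []]] t Iz //= e _.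
rewrite (uniqa b) (uniqa c).
have [_ _ /(_ s)] := (quad_idealE HG Hq qs_out L2 z).1 Iz.
rewrite /socle_coef (big_pred1 (out s)) => [|a]; last first.
  by rewrite (uniqa a) /= eqxx; apply/eqP; exact: qs_out.
rewrite (uniqa (sA HG (out s))) => /eqP; rewrite mulf_eq0 (negPf (kap_neq0 Hq _)) /=.
by move=> /eqP e0; rewrite -[RHS]e0; congr (coef z (_, _)); apply: one.
Qed.
End NotA2.

(** * The Koszul and d-Koszul equivalences *)

Theorem theorem2p4 (K : fieldType) (G : bgraph) (q : bE G -> bV G -> K) :
  is_bgraph G -> quantizing q ->
  (Koszul (bga q) <->
     quadratic (bga q) /\ (isA2 G \/ (forall s : bE G, ~~ etrunc s))) /\
  (forall d : nat, 3 <= d -> (dKoszul (bga q) d <-> d_homogeneous (bga q) d)).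
Proof.
move=> HG Hq; rewrite /bga; case: ifPn => [A2|nA2].
  split=> [|d d3].
    split=> [[HQ _]|[HQ _]]; first by split=> //; left; case/andP: A2.
    by split=> //; apply: xsq_res.
  by split=> [[]//|/xsq_homog]; rewrite leqNgt d3.
have [out qs_out] := fin_all_exists (edge_arrow HG nA2).
split=> [|d d3].
  split=> [[HQ [gen [mat [res dg]]]]|[HQ A2nt]].
    split=> //; right=> s; apply/negP => et.
    apply: (trunc_no_linear_res HG Hq qs_out (quadratic_clen HG Hq HQ) et res).
    by move=> n g /dg ->; apply: delta2.
  split=> //; apply: (quad_res HG Hq qs_out (quadratic_clen HG Hq HQ)).
  case: A2nt => // A2; exact: quadratic_A2_untruncated HG Hq nA2 A2 HQ.
split=> [[]//|Hd]; split=> //.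
exact: (star_res HG (homog3_trunc HG d3 Hd) qs_out Hd).
Qed.
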